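(* Let $n\ge 1$ and $m\ge 1$ be integers. For real polynomials $f(x)$ and $g(x)$ of degrees $n$ and $m$ respectively, consider the piecewise smooth planar system $$\dot{x}=y,\qquad \dot{y}=-x-\varepsilon\,\bigl(f(x)\,y+\operatorname{sgn}(y)\,g(x)\bigr).$$ Then, for $|\varepsilon|\neq 0$ sufficiently small, the number $\left[\frac{n}{2}\right]+\left[\frac{m}{2}\right]+1$ is a lower bound for the maximum number (over all such $f$ and $g$) of limit cycles of this system bifurcating from the periodic orbits of the linear center $\dot{x}=y$, $\dot{y}=-x$. Moreover, $f$ and $g$ can be chosen so that this number is achieved: there exist real polynomials $f$ of degree $n$ and $g$ of degree $m$ and $\varepsilon_0>0$ such that for every $\varepsilon$ with $0<|\varepsilon|<\varepsilon_0$ the system has $\left[\frac{n}{2}\right]+\left[\frac{m}{2}\right]+1$ limit cycles bifurcating from the periodic orbits of the linear center.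
   Context: $[\cdot]$ denotes the integer part. $\operatorname{sgn}(y)$ equals $1$ for $y>0$ and $-1$ for $y<0$, so the vector field is discontinuous along $\Sigma=\{y=0\}$. Let $X(x,y)=(y,\,-x-\varepsilon(f(x)y+g(x)))$ and $Y(x,y)=(y,\,-x-\varepsilon(f(x)y-g(x)))$ be the smooth pieces on $y>0$ and $y<0$, and put $h(x,y)=y$. A point $p\in\Sigma$ is a crossing point if $(X(p)\cdot\nabla h(p))(Y(p)\cdot\nabla h(p))>0$; through a crossing point the trajectory is defined by concatenating the trajectories of $X$ and $Y$. A limit cycle is an isolated periodic orbit of the piecewise smooth system (here, one meeting $\Sigma$ only at crossing points). The periodic orbits of the linear center are the circles $x^2+y^2=r_0^2$, $r_0>0$. A limit cycle bifurcates from the periodic orbits of the linear center if it belongs to a family of limit cycles, defined for small $|\varepsilon|\ne0$, which tends to one of these circles as $\varepsilon\to 0$; different limit cycles are counted as distinct. *)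

(* Defs.v *)
From HB Require Import structures.
From mathcomp Require Import all_boot all_order all_algebra.
From mathcomp Require Import all_classical all_reals all_analysis.

Set Implicit Arguments.
Unset Strict Implicit.
Unset Printing Implicit Defensive.

Import Order.TTheory GRing.Theory Num.Theory.
Import numFieldNormedType.Exports.

Local Open Scope classical_set_scope.
Local Open Scope ring_scope.

(* The sign [s] stands for sgn(y): [s = 1] gives the smooth piece X of the
   upper half plane and [s = -1] the smooth piece Y of the lower one. *)
Definition vfield (R : realType) (f g : {poly R}) (e s : R) (p : R * R) :
    R * R :=
  (p.2, - p.1 - e * (f.[p.1] * p.2 + s * g.[p.1])).

(* With h(x, y) = y, the derivative of h along a field Z at p is (Z p).2. *)
Definition crossing (R : realType) (f g : {poly R}) (e : R) (p : R * R) :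
    Prop :=
  p.2 = 0 /\ 0 < (vfield f g e 1 p).2 * (vfield f g e (-1) p).2.

(* A complete trajectory meeting y = 0 only at crossing points. At such a
   point both pieces have a second component of the same sign, which is the
   direction of crossing: the arc arriving at the point lies on the side
   opposite to that sign, and the arc leaving it on the side of that sign. *)
Definition trajectory (R : realType) (f g : {poly R}) (e : R)
    (c : R -> R * R) : Prop :=
  [/\ continuous c,
      forall t, (c t).2 != 0 ->
        is_derive t 1 (fun u => (c u).1)
          (vfield f g e (Num.sg (c t).2) (c t)).1 /\
        is_derive t 1 (fun u => (c u).2)
          (vfield f g e (Num.sg (c t).2) (c t)).2
    & forall t, (c t).2 = 0 ->
        [/\ crossing f g e (c t),
            \forall u \near t^'-, (vfield f g e 1 (c t)).2 * (c u).2 < 0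
          & \forall u \near t^'+, 0 < (vfield f g e 1 (c t)).2 * (c u).2]].

Definition periodic_orbit (R : realType) (f g : {poly R}) (e : R)
    (C : set (R * R)) : Prop :=
  exists (c : R -> R * R) (T : R),
    [/\ trajectory f g e c, 0 < T, forall t, c (t + T) = c t,
        (exists t, c t <> c 0) & C = range c].

Definition limit_cycle (R : realType) (f g : {poly R}) (e : R)
    (C : set (R * R)) : Prop :=
  periodic_orbit f g e C /\
  exists U : set (R * R),
    [/\ open U, C `<=` U
      & forall C', periodic_orbit f g e C' -> C' `<=` U -> C' = C].

Definition circle (R : realType) (r : R) : set (R * R) :=
  [set p | p.1 ^+ 2 + p.2 ^+ 2 = r ^+ 2].

(* Convergence for the Hausdorff distance. *)
Definition tends_to (R : realType) (G : R -> set (R * R)) (K : set (R * R)) :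
    Prop :=
  forall d : R, 0 < d -> \forall e \near (0 : R)^',
    (forall p, G e p -> exists2 q, K q & ball q d p) /\
    (forall q, K q -> exists2 p, G e p & ball p d q).

Definition bifurcating (R : realType) (f g : {poly R}) (e0 : R)
    (G : R -> set (R * R)) : Prop :=
  (forall e, 0 < `|e| < e0 -> limit_cycle f g e (G e)) /\
  exists2 r0 : R, 0 < r0 & tends_to G (circle r0).

Definition distinct_bifurcating (R : realType) (f g : {poly R}) (e0 : R)
    (k : nat) (G : 'I_k -> R -> set (R * R)) : Prop :=
  (forall i, bifurcating f g e0 (G i)) /\
  (forall e, 0 < `|e| < e0 -> forall i j, i != j -> G i e <> G j e).

(* The number of limit cycles bifurcating from the circles: the largest k (or
   +oo) for which there are k families of limit cycles that are pairwise
   distinct for every small nonzero parameter. Counting families rather than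
   orbits at one fixed parameter is needed because tending to a circle is a
   property of the whole family. *)
Definition bif_number (R : realType) (f g : {poly R}) : \bar R :=
  ereal_sup [set k%:R%:E | k in [set k : nat |
    exists (e0 : R) (G : 'I_k -> R -> set (R * R)),
      0 < e0 /\ distinct_bifurcating f g e0 G]].

Definition max_bif_number (R : realType) (n m : nat) : \bar R :=
  ereal_sup [set b | exists f g : {poly R},
    [/\ size f = n.+1, size g = m.+1 & b = bif_number f g]].

(* Main.v *)
Require Import Defs.
From HB Require Import structures.
From mathcomp Require Import all_boot all_order all_algebra.
From mathcomp Require Import all_classical all_reals all_analysis.
From mathcomp Require Import ring lra zify.

(** The plane is folded along the x axis. In the radius r and the folded angle a
    (x = r sin a, |y| = r cos a), the flow above the axis is a scalar equation
    dr/da = n * slope n a r with n = e, and the flow below the axis, read in the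
    direction of increasing a, is the same equation with n = - e. A closed curve
    around the origin is therefore a periodic orbit as soon as it consists of a
    solution for e and a solution for - e that agree at a = - pi/2 and at
    a = pi/2. To first order in e the gap at pi/2 between two solutions that start
    together at radius r is 2 e M(r), where M(r) is the integral of
    [radial f g a r], that is of slope 0 a r, over [- pi/2, pi/2].

    M is a polynomial in r. By parity, only the even coefficients of f and of g
    contribute: those of f the powers 1, 3, ..., 2[n/2] + 1, and those of g the
    powers 0, 2, ..., 2[m/2]. These [n/2] + [m/2] + 2 coefficients can be
    prescribed ([prescribed_average]). With N = [n/2] + [m/2] + 1, interpolation
    gives such an M vanishing at 1, ..., N, and a count of roots in the manner of
    Descartes shows that all its coefficients are nonzero, that it has no other
    positive root and that these roots are simple ([sparse_poly]).

    Near a simple root q there is, for small nonzero e, exactly one periodic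
    orbit ([simple_root_orbit]). Existence: solutions of the scalar equation come
    from Picard iteration, the gap changes sign near q ([closing_solutions]), and
    the closed curve is turned into a trajectory by inverting the time as a
    function of the angle ([closed_orbit]). Uniqueness rests on Lyapunov
    functions: a continuous function of the position cannot be strictly monotone
    along a periodic trajectory. Applied to the corrected difference between the
    radius and that of the constructed orbit, this shows that another orbit lies
    on the first one ([on_closed_orbit]); as it turns around the origin it meets
    every ray ([meets_ray]), so both are equal. The same principle, applied to
    the corrected radius, excludes periodic orbits near a circle whose radius is
    not a root ([no_orbit]).

    Hence each of the N roots carries one family of limit cycles tending to its
    circle, every family tends to the circle of one of these roots, and two
    families with the same limit coincide for small e. So f and g have exactly N
    bifurcating families. *)

Set Implicit Arguments.
Unset Strict Implicit.
Unset Printing Implicit Defensive.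

Import Order.TTheory GRing.Theory Num.Theory.
Import numFieldNormedType.Exports.

Local Open Scope classical_set_scope.
Local Open Scope ring_scope.

(** * Calculus on the real line *)

Section Calculus.
Variable R : realType.
Implicit Types f g : R -> R.

Notation der f t d := (is_derive (t : R) (1 : R) (f : R -> R) (d : R)).

Lemma der_eq f t d d' : der f t d -> d = d' -> der f t d'.
Proof. by move=> h <-. Qed.

Lemma der_cst (a t : R) : der (fun=> a) t 0.
Proof. exact: is_derive_cst. Qed.

Lemma der_id (t : R) : der id t 1.
Proof. exact: is_derive_id. Qed.

Lemma der_add f g t a b : der f t a -> der g t b ->
  der (fun u => f u + g u) t (a + b).
Proof. by move=> fa gb; exact: is_deriveD. Qed.

Lemma der_opp f t a : der f t a -> der (fun u => - f u) t (- a).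
Proof. by move=> fa; exact: is_deriveN. Qed.

Lemma der_sub f g t a b : der f t a -> der g t b ->
  der (fun u => f u - g u) t (a - b).
Proof. by move=> fa gb; exact: is_deriveB. Qed.

Lemma der_mul f g t a b : der f t a -> der g t b ->
  der (fun u => f u * g u) t (a * g t + f t * b).
Proof.
move=> fa gb; have h := is_deriveM fa gb.
by apply: (der_eq h); rewrite /GRing.scale /=; ring.
Qed.

Lemma der_scale f t (k : R) a : der f t a -> der (fun u => k * f u) t (k * a).
Proof.
by move=> fa; apply: (der_eq (der_mul (der_cst k t) fa)); ring.
Qed.

Lemma der_comp f g t a b : der f (g t) a -> der g t b ->
  der (fun u => f (g u)) t (a * b).
Proof. by move=> fa gb; exact: is_derive1_comp. Qed.

Lemma der_inv f t a : der f t a -> f t != 0 ->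
  der (fun u => (f u)^-1) t (- a / f t ^+ 2).
Proof.
move=> fa f0; apply: (der_eq (is_deriveV f0 fa)).
by rewrite /GRing.scale /= !mulNr mulrC.
Qed.

Lemma der_div f g t a b : der f t a -> der g t b -> g t != 0 ->
  der (fun u => f u / g u) t ((a * g t - f t * b) / g t ^+ 2).
Proof.
move=> fa gb g0; apply: (der_eq (der_mul fa (der_inv gb g0))).
by field.
Qed.

Lemma der_sqrt f t a : der f t a -> 0 < f t ->
  der (fun u => Num.sqrt (f u)) t (a / (2 * Num.sqrt (f t))).
Proof.
move=> fa f0; apply: (der_eq (der_comp (is_derive1_sqrt f0) fa)).
by rewrite mulrC.
Qed.

Lemma der_near f g t a : (\forall u \near t, f u = g u) ->
  der f t a -> der g t a.
Proof. exact: near_eq_is_derive. Qed.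

Lemma der_cont f t a : der f t a -> {for t, continuous f}.
Proof.
by move=> h; apply/differentiable_continuous/derivable1_diffP; case: h.
Qed.

Lemma der_unique f t a b : der f t a -> der f t b -> a = b.
Proof. by move=> [_ <-] [_ <-]. Qed.

Lemma continuous_for f : (forall t, {for t, continuous f}) -> continuous f.
Proof. by []. Qed.

Lemma cont_cst (a t : R) : {for t, continuous (fun=> a : R)}.
Proof. exact: cvg_cst. Qed.

Lemma cont_add f g t : {for t, continuous f} -> {for t, continuous g} ->
  {for t, continuous (fun u => f u + g u)}.
Proof. by move=> fc gc; exact: (cvgD fc gc). Qed.

Lemma cont_sub f g t : {for t, continuous f} -> {for t, continuous g} ->
  {for t, continuous (fun u => f u - g u)}.
Proof. by move=> fc gc; exact: (cvgB fc gc). Qed.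

Lemma cont_opp f t : {for t, continuous f} ->
  {for t, continuous (fun u => - f u)}.
Proof. by move=> fc; exact: (cvgN fc). Qed.

Lemma cont_mul f g t : {for t, continuous f} -> {for t, continuous g} ->
  {for t, continuous (fun u => f u * g u)}.
Proof. by move=> fc gc; exact: (cvgM fc gc). Qed.

Lemma cont_div f g t : {for t, continuous f} -> {for t, continuous g} ->
  g t != 0 -> {for t, continuous (fun u => f u / g u)}.
Proof. by move=> fc gc g0; exact: (cvgM fc (cvgV g0 gc)). Qed.

Lemma cont_comp f g t : {for g t, continuous f} -> {for t, continuous g} ->
  {for t, continuous (fun u => f (g u))}.
Proof. by move=> fc gc; exact: (continuous_comp gc fc). Qed.

Lemma cont_within f a b : (forall x, a <= x <= b -> {for x, continuous f}) ->
  {within `[a, b], continuous f}.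
Proof.
move=> fc; apply: continuous_in_subspaceT => x.
by rewrite inE /= in_itv /=; apply: fc.
Qed.

Lemma mean_value f df a b : a < b ->
  (forall x, a <= x <= b -> {for x, continuous f}) ->
  (forall x, a < x < b -> der f x (df x)) ->
  exists2 c, a < c < b & f b - f a = df c * (b - a).
Proof.
move=> ab fc fd; have fd' x : x \in `]a, b[ -> der f x (df x).
  by rewrite in_itv /=; exact: fd.
have [c cab e] := @MVT _ f df _ _ ab fd' (cont_within fc).
by exists c => //; move: cab; rewrite in_itv.
Qed.

Lemma mean_value_le f df a b (K : R) : a <= b ->
  (forall x, a <= x <= b -> {for x, continuous f}) ->
  (forall x, a < x < b -> der f x (df x)) ->
  (forall x, a < x < b -> `|df x| <= K) -> `|f b - f a| <= K * (b - a).
Proof.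
rewrite le_eqVlt => /predU1P[-> _ _ _|ab fc fd fK].
  by rewrite !subrr normr0 mulr0.
have [c cab ->] := mean_value ab fc fd.
by rewrite normrM ler_pM ?normr_ge0 ?fK// ger0_norm// subr_ge0 ltW.
Qed.

Lemma der0_cst f : (forall t, der f t 0) -> forall s t, f s = f t.
Proof. by move=> h s t; exact: is_derive_0_is_cst. Qed.

Local Notation mu := (@lebesgue_measure R).

Lemma primitive_from f (A : R) : continuous f ->
  exists F : R -> R, forall x, A < x -> der F x (f x).
Proof.
move=> fc; exists (fun x => \int[mu]_(t in `[A, x]) f t)%R => x Ax.
have h : mu.-integrable `[A, x + 1] (EFin \o f).
  apply: continuous_compact_integrable; first exact: segment_compact.
  exact: continuous_subspaceT.
have [dF <-] := continuous_FTC1_closed (ltr_pwDr ltr01 (lexx x)) h Ax (fc x).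
by rewrite derive1E; exact: derivableP.
Qed.

(** Integrals with different base points differ by constants; near each [x] the
    primitive is read off from a base point far enough to the left, which gives
    a two-sided derivative everywhere. *)
Lemma primitive f : continuous f ->
  exists F : R -> R, F 0 = 0 /\ forall x, der F x (f x).
Proof.
move=> fc.
have [G hG] := choice (fun A => primitive_from A fc).
pose H (A x : R) := G A x - G A 0.
have HE A B x : A < x -> B < x -> A < 0 -> B < 0 -> H A x = H B x.
  move=> Ax Bx A0 B0.
  have key a b : a <= b -> A < a -> B < a ->
      `|(G A b - G B b) - (G A a - G B a)| <= 0 * (b - a).
    move=> ab Aa Ba; apply: (@mean_value_le (fun x => G A x - G B x)
        (fun x => f x - f x)) => //.
    - move=> y /andP[ay _].
      apply: (@der_cont _ _ (f y - f y)).
      by apply: der_sub; apply: hG; exact: lt_le_trans ay.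
    - by move=> y /andP[ay _]; apply: der_sub; apply: hG; exact: lt_trans ay.
    - by move=> y _; rewrite subrr normr0.
  have key0 a b : a <= b -> A < a -> B < a ->
      G A b - G B b = G A a - G B a.
    move=> ab Aa Ba; apply/eqP; rewrite -subr_eq0 -normr_le0.
    by have := key a b ab Aa Ba; rewrite mul0r.
  rewrite /H; case: (leP 0 x) => x0.
    by have := key0 0 x x0 A0 B0; lra.
  by have := key0 x 0 (ltW x0) Ax Bx; lra.
exists (fun x => H (- (`|x| + 1)) x); split; first by rewrite /H subrr.
move=> x.
apply: (@der_near (H (- (`|x| + 3)))).
  exists 1 => //= y; rewrite /= => xy.
  have := ler_norm (- y); have := normr_ge0 y; have := normr_ge0 x.
  have := ler_distD x y 0; rewrite !subr0 distrC normrN => h1 h2 h3 h4.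
  by apply: HE; lra.
apply: (der_eq (der_sub (hG _ x _) (der_cst _ x))); last by rewrite subr0.
by have := ler_norm (- x); have := normr_ge0 x; rewrite normrN; lra.
Qed.

End Calculus.

(** * Monotonicity through isolated corners *)

Section Gate.
Variable R : realType.
Implicit Types f g h k V : R -> R.
Notation der f t d := (is_derive (t : R) (1 : R) (f : R -> R) (d : R)).

Lemma sg_near h (t : R) : {for t, continuous h} -> h t != 0 ->
  \forall u \near t, Num.sg (h u) = Num.sg (h t).
Proof.
move=> hc h0.
have := hc; move/cvgrPdist_lt => /(_ `|h t|); rewrite normr_gt0 => /(_ h0).
apply: filterS => u; rewrite ltr_norml => /andP[h1 h2].
have [hp|hn|e] := ltgtP (h t) 0; last by rewrite e eqxx in h0.
  by rewrite ltr0_norm// in h1 h2; rewrite !ltr0_sg//; lra.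
by rewrite gtr0_norm// in h1 h2; rewrite !gtr0_sg//; lra.
Qed.

(** The jump of the sign is harmless where the other factor vanishes. Functions
    given by different formulas above and below the axis are written with a
    factor [Num.sg y] so as to be glued by this lemma. *)
Lemma sg_mul_continuous h k (t : R) : {for t, continuous h} ->
  {for t, continuous k} -> (h t = 0 -> k t = 0) ->
  {for t, continuous (fun u => Num.sg (h u) * k u)}.
Proof.
move=> hc kc hk; have [h0|h0] := eqVneq (h t) 0.
  rewrite /prop_for /continuous_at h0 sgr0 mul0r.
  apply/cvgrPdist_lt => e e0.
  move/cvgrPdist_lt : kc => /(_ e e0); apply: filterS => u.
  rewrite hk// !sub0r !normrN; apply: le_lt_trans.
  by rewrite normrM normr_sg ler_piMl//; case: (h u != 0).
have hs := sg_near hc h0.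
apply: (@cvg_trans _ ((fun u => Num.sg (h t) * k u) @ t)).
  by apply: near_eq_cvg; apply: filterS hs => u ->.
exact: (cvgM (cvg_cst (Num.sg (h t))) kc).
Qed.

Lemma sg_mul_der h k (t : R) d : {for t, continuous h} -> h t != 0 ->
  der k t d -> der (fun u => Num.sg (h u) * k u) t (Num.sg (h t) * d).
Proof.
move=> hc h0 kd; apply: der_near (der_scale _ kd).
by apply: filterS (sg_near hc h0) => u ->.
Qed.

(** The zeros of [k] are exceptional points, each of which is left at once to
    the right. After adding a small slope [d], [V] increases strictly to the
    right of every point, so its maximum over [[a, b]] can only be at [b]. *)
Lemma gate_nondecreasing V k : continuous V -> continuous k ->
  (forall t, k t != 0 -> exists2 d, der V t d & 0 <= d) ->
  (forall t, k t = 0 -> \forall u \near t^'+, k u != 0) ->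
  forall a b, a <= b -> V a <= V b.
Proof.
move=> Vc kc Vd kn.
have loc t : \forall u \near t^'+, V t <= V u.
  have : \forall u \near t^'+, k u != 0.
    have [/kn//|k0] := eqVneq (k t) 0.
    rewrite near_withinE; apply: filterS (sg_near (kc t) k0) => u e _.
    by rewrite -sgr_eq0 e sgr_eq0.
  move=> [e /= e0 He]; exists e => //= u /= tu u0.
  have Vd' x : exists d, k x != 0 -> der V x d /\ 0 <= d.
    have [k0|k0] := eqVneq (k x) 0; first by exists 0.
    by have [d] := Vd x k0; exists d.
  have [d hd] := choice Vd'.
  have kx x : t < x < u -> k x != 0.
    move=> /andP[h1 h2]; apply: He => //=.
    by move: tu; rewrite !ltr_norml => /andP[h3 h4]; apply/andP; split; lra.
  have [c cab e1] := @mean_value _ V d _ _ u0 (fun x _ => Vc x)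
     (fun x hx => (hd x (kx x hx)).1).
  rewrite -subr_ge0 e1 mulr_ge0 ?(hd _ (kx _ cab)).2//.
  by rewrite subr_ge0 ltW.
move=> a b ab; apply/ler_addgt0Pr => e e0.
pose d := e / (b - a + 1).
have d0 : 0 < d by rewrite divr_gt0//; lra.
have dE : d * (b - a) <= e.
  by rewrite /d mulrAC ler_pdivrMr ?ler_pM2l//; lra.
have [|c] := @EVT_max R (fun t => V t + d * t) a b ab.
  apply: continuous_subspaceT => x; apply: cvgD; first exact: Vc.
  by apply: cvgM; [exact: cvg_cst|exact: cvg_id].
rewrite in_itv /= => /andP[ac cb] cmax.
suff cbE : c = b.
  have := cmax a; rewrite in_itv /= lexx ab => /(_ isT).
  by rewrite cbE; lra.
apply/eqP; move: cb; rewrite le_eqVlt => /orP[//|cb].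
exfalso.
have [u [ul cu ub]] : exists u, [/\ V c <= V u, c < u & u < b].
  near c^'+ => u.
  exists u; split; near: u; [exact: loc|exact: nbhs_right_gt|].
  exact: nbhs_right_lt.
have := cmax u; rewrite in_itv /= (ltW ub) (ltW (le_lt_trans ac cu)) => /(_ isT).
have : d * c < d * u by rewrite ltr_pM2l.
by lra.
Unshelve. all: by end_near.
Qed.

End Gate.

Section Lyapunov.
Variables (R : realType) (f g : {poly R}) (e : R) (c : R -> R * R) (T : R).
Hypotheses (cT : trajectory f g e c) (T0 : 0 < T).
Notation der f t d := (is_derive (t : R) (1 : R) (f : R -> R) (d : R)).

Lemma traj_x_cont : continuous (fun t => (c t).1).
Proof.
by case: cT => h _ _ t; apply: (@continuous_comp _ _ _ c fst t (h t)); exact: cvg_fst.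
Qed.

Lemma traj_y_cont : continuous (fun t => (c t).2).
Proof.
by case: cT => h _ _ t; apply: (@continuous_comp _ _ _ c snd t (h t)); exact: cvg_snd.
Qed.

Lemma traj_leaves_axis t : (c t).2 = 0 -> \forall u \near t^'+, (c u).2 != 0.
Proof.
move=> h; case: cT => _ _ /(_ t h)[_ _].
by apply: filterS => u; apply: contraTneq => ->; rewrite mulr0 ltxx.
Qed.

Lemma traj_off_axis : exists t, (c t).2 != 0.
Proof.
have [h|h] := eqVneq (c 0).2 0; last by exists 0.
near (0 : R)^'+ => u; exists u; near: u; exact: traj_leaves_axis.
Unshelve. all: by end_near.
Qed.

(** A periodic function that is nondecreasing is constant. *)
Lemma lyapunov_pos (V d : R -> R) : continuous V ->
  (forall t, V (t + T) = V t) ->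
  (forall t, (c t).2 != 0 -> der V t (d t)) ->
  (forall t, (c t).2 != 0 -> 0 <= d t) ->
  forall t, (c t).2 != 0 -> d t = 0.
Proof.
move=> Vc VT Vd d0 t yt.
have mono a b : a <= b -> V a <= V b.
  apply: (@gate_nondecreasing _ V (fun t => (c t).2)) => //.
  - exact: traj_y_cont.
  - by move=> u yu; exists (d u); [exact: Vd|exact: d0].
  - exact: traj_leaves_axis.
have Vcst : \forall u \near t, V t = V u.
  exists T => //= u /=; rewrite ltr_norml => /andP[h1 h2].
  have [tu|/ltW ut] := leP t u; apply: le_anti; apply/andP; split.
  - exact: mono.
  - by rewrite -(VT t) mono//; lra.
  - by rewrite -(VT u) mono//; lra.
  - exact: mono.
by apply: (der_unique (Vd t yt)); apply: der_near (der_cst (V t) t).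
Qed.

Lemma lyapunov (V d : R -> R) (a : R) : a != 0 -> continuous V ->
  (forall t, V (t + T) = V t) ->
  (forall t, (c t).2 != 0 -> der V t (d t)) ->
  (forall t, (c t).2 != 0 -> 0 <= a * d t) ->
  forall t, (c t).2 != 0 -> d t = 0.
Proof.
move=> a0 Vc VT Vd d0 t yt.
have /eqP : a * d t = 0.
  apply: (@lyapunov_pos (fun u => a * V u) (fun u => a * d u)) => //.
  - by move=> u; apply: cvgM; [exact: cvg_cst|exact: Vc].
  - by move=> u; rewrite VT.
  - by move=> u yu; apply: der_scale; exact: Vd.
by rewrite mulf_eq0 (negbTE a0) => /eqP.
Qed.

End Lyapunov.
Arguments traj_x_cont {R f g e c} cT _.
Arguments traj_y_cont {R f g e c} cT _.

(** * The polar angle by the half-angle formula *)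

Section Angle.
Variable R : realType.
Notation der f t d := (is_derive (t : R) (1 : R) (f : R -> R) (d : R)).

Definition norm2 (x y : R) := Num.sqrt (x ^+ 2 + y ^+ 2).

(** The angle of the point (x, y), measured clockwise from the positive y axis:
    the direction of rotation of the center. The half-angle formula makes it
    smooth outside the negative y axis, with no case distinction. *)
Definition clock (x y : R) := 2 * atan (x / (norm2 x y + y)).

Lemma norm2_ge0 x y : 0 <= norm2 x y. Proof. exact: sqrtr_ge0. Qed.

Lemma norm2_sqr x y : norm2 x y ^+ 2 = x ^+ 2 + y ^+ 2.
Proof. by rewrite sqr_sqrtr// addr_ge0// sqr_ge0. Qed.

Lemma norm2_gt0 x y : (0 < norm2 x y) = ((x != 0) || (y != 0)).
Proof.
rewrite sqrtr_gt0 lt_def addr_ge0 ?sqr_ge0// andbT.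
by rewrite paddr_eq0 ?sqr_ge0// !sqrf_eq0 negb_and.
Qed.

Lemma norm2_sym x y : norm2 x `|y| = norm2 x y.
Proof. by rewrite /norm2 real_normK ?num_real. Qed.

Lemma norm2Z k x y : 0 <= k -> norm2 (k * x) (k * y) = k * norm2 x y.
Proof.
move=> k0; rewrite /norm2 !exprMn -mulrDr sqrtrM ?sqr_ge0//.
by rewrite sqrtr_sqr ger0_norm.
Qed.

Lemma norm2_ge_x x y : `|x| <= norm2 x y.
Proof. by rewrite -sqrtr_sqr ler_wsqrtr// lerDl sqr_ge0. Qed.

Lemma norm2_ge_y x y : `|y| <= norm2 x y.
Proof. by rewrite -sqrtr_sqr ler_wsqrtr// lerDr sqr_ge0. Qed.

Lemma half_angle x y : 0 < norm2 x y -> 0 < norm2 x y + y ->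
  (1 + (x / (norm2 x y + y)) ^+ 2)^-1 = (norm2 x y + y) / (2 * norm2 x y).
Proof.
move=> r0 w0; have := norm2_sqr x y; move: r0 w0; set r := norm2 x y => r0 w0 e.
have -> : 1 + (x / (r + y)) ^+ 2 = 2 * r / (r + y).
  have -> : 1 + (x / (r + y)) ^+ 2 = ((r + y) ^+ 2 + x ^+ 2) / (r + y) ^+ 2.
    by field; rewrite gt_eqF.
  have -> : (r + y) ^+ 2 + x ^+ 2 = 2 * r * (r + y).
    by have -> : x ^+ 2 = r ^+ 2 - y ^+ 2 by [rewrite e; ring]; ring.
  by field; rewrite gt_eqF.
by rewrite invf_div.
Qed.

Lemma sin_double_atan (z : R) : sin (2 * atan z) = 2 * z * (1 + z ^+ 2)^-1.
Proof.
have c0 : cos (atan z) != 0.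
  by rewrite cos_atan invr_eq0 gt_eqF// sqrtr_gt0 ltr_pwDl// sqr_ge0.
have sE : sin (atan z) = z * cos (atan z).
  by rewrite -{2}[z]atanK /tan divfK.
rewrite mulrC mulr_natr sin_mulr2n sE.
have -> : (1 + z ^+ 2)^-1 = cos (atan z) ^+ 2.
  by rewrite cos_atan exprVn sqr_sqrtr// addr_ge0 ?sqr_ge0.
by ring.
Qed.

Lemma cos_double_atan (z : R) :
  cos (2 * atan z) = 2 * (1 + z ^+ 2)^-1 - 1.
Proof.
rewrite mulrC mulr_natr cos_mulr2n.
have -> : (1 + z ^+ 2)^-1 = cos (atan z) ^+ 2.
  by rewrite cos_atan exprVn sqr_sqrtr// addr_ge0 ?sqr_ge0.
by ring.
Qed.

Lemma sin_clock x y : 0 < norm2 x y -> 0 < norm2 x y + y ->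
  sin (clock x y) = x / norm2 x y.
Proof.
move=> r0 w0; rewrite sin_double_atan half_angle//.
by field; rewrite !gt_eqF.
Qed.

Lemma cos_clock x y : 0 < norm2 x y -> 0 < norm2 x y + y ->
  cos (clock x y) = y / norm2 x y.
Proof.
move=> r0 w0; rewrite cos_double_atan half_angle//.
by field; rewrite !gt_eqF.
Qed.

Lemma clock_bound x y : `|clock x y| < pi.
Proof.
rewrite /clock; set z := _ / _.
have h1 := atan_gtNpi2 z; have h2 := atan_ltpi2 z.
by rewrite ltr_norml; apply/andP; split; lra.
Qed.

Section Along.
Variables (X Y : R -> R) (t X' Y' : R).
Hypotheses (dX : der X t X') (dY : der Y t Y').

Lemma der_norm2 : 0 < norm2 (X t) (Y t) ->
  der (fun u => norm2 (X u) (Y u)) t ((X t * X' + Y t * Y') / norm2 (X t) (Y t)).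
Proof.
move=> r0.
have h : der (fun u => X u ^+ 2 + Y u ^+ 2) t
    (X' * X t + X t * X' + (Y' * Y t + Y t * Y')).
  by apply: der_add; apply: der_mul.
apply: (der_eq (der_sqrt h _)); first by rewrite -sqrtr_gt0.
by rewrite -/(norm2 _ _); field; rewrite gt_eqF.
Qed.

Lemma der_clock : 0 < norm2 (X t) (Y t) -> 0 < norm2 (X t) (Y t) + Y t ->
  der (fun u => clock (X u) (Y u)) t
    ((Y t * X' - X t * Y') / norm2 (X t) (Y t) ^+ 2).
Proof.
move=> r0 w0.
have dw := der_add (der_norm2 r0) dY.
have w0' : norm2 (X t) (Y t) + Y t != 0 by rewrite gt_eqF.
have dz := der_div dX dw w0'.
apply: (der_eq (der_scale 2 (der_comp (is_derive1_atan _) dz))).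
rewrite half_angle//.
have := norm2_sqr (X t) (Y t); move: r0 w0; set r := norm2 _ _ => r0 w0 e.
have r0' : r != 0 by rewrite gt_eqF.
transitivity ((X' * r * (r + Y t) - X t * r * Y' - Y t * Y' * X t
    - (r ^+ 2 - Y t ^+ 2) * X') / (r ^+ 2 * (r + Y t))).
  have -> : r ^+ 2 - Y t ^+ 2 = X t ^+ 2 by rewrite e; ring.
  by field; rewrite r0' gt_eqF.
by field; rewrite r0' gt_eqF.
Qed.

End Along.

Lemma norm2_cont (X Y : R -> R) t : {for t, continuous X} ->
  {for t, continuous Y} -> {for t, continuous (fun u => norm2 (X u) (Y u))}.
Proof.
move=> Xc Yc; apply: continuous_comp; last exact: sqrt_continuous.
by apply: cvgD; apply: cvgM.
Qed.

Lemma clock_cont (X Y : R -> R) t : {for t, continuous X} ->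
  {for t, continuous Y} -> 0 < norm2 (X t) (Y t) + Y t ->
  {for t, continuous (fun u => clock (X u) (Y u))}.
Proof.
move=> Xc Yc w0; apply: cvgM; first exact: cvg_cst.
apply: (@continuous_comp _ _ _ (fun u => X u / (norm2 (X u) (Y u) + Y u)) atan).
  apply: cvgM => //; apply: cvgV; first by rewrite gt_eqF.
  by apply: cvgD => //; exact: norm2_cont.
exact: continuous_atan.
Qed.

End Angle.

(** * Trajectories in folded polar coordinates *)

Section Polar.
Variable R : realType.
Notation der f t d := (is_derive (t : R) (1 : R) (f : R -> R) (d : R)).

Definition nrm (p : R * R) : R := norm2 p.1 p.2.
(** The plane is folded along the x axis: both half planes are described by the
    radius and an angle between -pi/2 and pi/2, at which x = r sin a and
    |y| = r cos a. *)
Definition ang (p : R * R) : R := clock p.1 `|p.2|.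

(** This is f(x) |y| + g(x). With this choice the two pieces of the vector
    field differ only by the sign of the parameter. *)
Definition force (f g : {poly R}) (a r : R) : R :=
  f.[r * sin a] * (r * cos a) + g.[r * sin a].

Lemma nrm_fold p : 0 < nrm p -> 0 < norm2 p.1 `|p.2| + `|p.2|.
Proof. by move=> h; rewrite norm2_sym ltr_pwDl. Qed.

Lemma sin_ang p : 0 < nrm p -> sin (ang p) = p.1 / nrm p.
Proof.
by move=> h; rewrite /ang sin_clock ?nrm_fold ?norm2_sym.
Qed.

Lemma cos_ang p : 0 < nrm p -> cos (ang p) = `|p.2| / nrm p.
Proof.
by move=> h; rewrite /ang cos_clock ?nrm_fold ?norm2_sym.
Qed.

Lemma nrm_sin p : 0 < nrm p -> nrm p * sin (ang p) = p.1.
Proof. by move=> h; rewrite sin_ang// mulrC divfK// gt_eqF. Qed.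

Lemma nrm_cos p : 0 < nrm p -> nrm p * cos (ang p) = `|p.2|.
Proof. by move=> h; rewrite cos_ang// mulrC divfK// gt_eqF. Qed.

Lemma ang_axis p : 0 < nrm p -> p.2 = 0 ->
  (ang p = pi / 2 \/ ang p = - (pi / 2)).
Proof.
move=> r0 p2; have p1 : p.1 != 0 by move: r0; rewrite /nrm norm2_gt0 p2 eqxx orbF.
rewrite /ang /clock p2 normr0 addr0 /norm2 expr0n addr0 sqrtr_sqr.
have [h|h] := ltrP p.1 0.
  right; rewrite ltr0_norm// invrN mulrN divff// atanN atan1; lra.
by left; rewrite ger0_norm// divff// atan1; lra.
Qed.

Lemma ang_bound p : `|ang p| < pi.
Proof. exact: clock_bound. Qed.

Lemma angZ k p : 0 < k -> 0 < nrm p -> ang (k * p.1, k * p.2) = ang p.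
Proof.
move=> k0 r0; rewrite /ang /clock /= normrM gtr0_norm// norm2Z ?ltW// -mulrDr.
congr (2 * atan _); rewrite -mulf_div divff ?mul1r// ?gt_eqF//.
Qed.

Lemma nrmZ k p : 0 <= k -> nrm (k * p.1, k * p.2) = k * nrm p.
Proof. by move=> k0; rewrite /nrm norm2Z. Qed.

Section Trajectory.
Variables (f g : {poly R}) (e : R) (c : R -> R * R).
Hypothesis cT : trajectory f g e c.

Lemma traj_nrm_cont : continuous (fun t => nrm (c t)).
Proof.
by move=> t; apply: norm2_cont; [exact: (traj_x_cont cT)|exact: (traj_y_cont cT)].
Qed.

Lemma traj_ang_cont t : 0 < nrm (c t) -> {for t, continuous (fun u => ang (c u))}.
Proof.
move=> r0; apply: clock_cont; last exact: nrm_fold.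
  exact: (traj_x_cont cT).
by apply: continuous_comp; [exact: (traj_y_cont cT)|exact: norm_continuous].
Qed.

Lemma traj_der t : (c t).2 != 0 ->
  der (fun u => (c u).1) t (c t).2 /\
  der (fun u => (c u).2) t (- (c t).1
     - e * (f.[(c t).1] * (c t).2 + Num.sg (c t).2 * g.[(c t).1])).
Proof. by case: cT => _ + _ => /(_ t)/[apply]. Qed.

(** From r r' = x x' + y y' and r^2 a' = |y| x' - x |y|'. *)
Lemma traj_polar t : (c t).2 != 0 ->
  let Q := force f g (ang (c t)) (nrm (c t)) in
  der (fun u => nrm (c u)) t (- e * (cos (ang (c t)) * Q)) /\
  der (fun u => ang (c u)) t (Num.sg (c t).2 *
    (1 + Num.sg (c t).2 * e * (sin (ang (c t)) * Q / nrm (c t)))).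
Proof.
move=> y0 Q; have [dx dy] := traj_der y0.
have r0 : 0 < nrm (c t) by rewrite /nrm norm2_gt0 y0 orbT.
have r0' : nrm (c t) != 0 by rewrite gt_eqF.
have QE : Q = f.[(c t).1] * `|(c t).2| + g.[(c t).1].
  by rewrite /Q /force nrm_sin// nrm_cos.
have s2 : Num.sg (c t).2 * Num.sg (c t).2 = 1 by rewrite -expr2 sqr_sg y0.
have yE := numEsg (c t).2; have nE := normrEsg (c t).2.
have rr := norm2_sqr (c t).1 (c t).2; rewrite -/(nrm (c t)) in rr.
split.
  apply: (der_eq (der_norm2 dx dy r0)); rewrite -/(nrm (c t)) QE cos_ang// nE.
  move: s2; set s := Num.sg _; set x := (c t).1; set y := (c t).2 => s2.
  transitivity (- e * (f.[x] * y ^+ 2 + s * y * g.[x]) / nrm (c t)).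
    by field.
  transitivity (- e * (f.[x] * (s * s) * y ^+ 2 + s * y * g.[x]) / nrm (c t)).
    by rewrite s2 mulr1.
  by field.
have dn : der (fun u => `|(c u).2|) t (Num.sg (c t).2 * (- (c t).1
     - e * (f.[(c t).1] * (c t).2 + Num.sg (c t).2 * g.[(c t).1]))).
  have h := sg_mul_der (traj_y_cont cT t) y0 dy.
  by apply: (der_near _ h); exists 1 => //= u _; rewrite normrEsg.
have r1 : 0 < norm2 (c t).1 `|(c t).2| by rewrite norm2_sym.
apply: (der_eq (der_clock dx dn r1 (nrm_fold r0))).
rewrite norm2_sym -/(nrm (c t)) QE sin_ang// nE.
move: s2 rr; set s := Num.sg _; set x := (c t).1; set y := (c t).2 => s2 rr.
set r := nrm _ in rr r0' *.
transitivity ((s * (x ^+ 2 + y ^+ 2) + s * s * x * e * (f.[x] * (s * y) + g.[x])) / r ^+ 2).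
  rewrite s2; congr (_ / _).
  have -> : s * (- x - e * (f.[x] * y + s * g.[x])) =
     - (s * x) - e * (f.[x] * (s * y) + (s * s) * g.[x]) by ring.
  by rewrite s2; ring.
rewrite -rr.
by field.
Qed.

(** In the frame whose negative Y axis is the ray through [q], the clock angle
    of a trajectory avoiding the ray would be a continuous periodic function
    with a positive derivative off the x axis. *)
Lemma meets_ray (T : R) (q : R * R) : 0 < T -> (forall t, c (t + T) = c t) ->
  0 < nrm q -> (forall t, 0 < nrm (c t)) ->
  (forall t, (c t).2 != 0 -> `|e| *
     `|sin (ang (c t)) * force f g (ang (c t)) (nrm (c t)) / nrm (c t)| < 1) ->
  exists t, exists2 k : R, 0 < k & c t = (k * q.1, k * q.2).
Proof.
move=> T0 cper q0 c0 small; apply: contrapT => nray.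
pose u1 := q.1 / nrm q; pose u2 := q.2 / nrm q.
have uu : u1 ^+ 2 + u2 ^+ 2 = 1.
  by rewrite !expr_div_n -mulrDl -norm2_sqr divff// expf_neq0// gt_eqF.
pose X t := - ((c t).1 * u2 - (c t).2 * u1).
pose Y t := - ((c t).1 * u1 + (c t).2 * u2).
have xc := traj_x_cont cT; have yc := traj_y_cont cT.
have Xc : continuous X.
  move=> t; apply: cvgN; apply: cvgB.
    by apply: cvgM; [exact: xc|exact: cvg_cst].
  by apply: cvgM; [exact: yc|exact: cvg_cst].
have Yc : continuous Y.
  move=> t; apply: cvgN; apply: cvgD.
    by apply: cvgM; [exact: xc|exact: cvg_cst].
  by apply: cvgM; [exact: yc|exact: cvg_cst].
have XY t : norm2 (X t) (Y t) = nrm (c t).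
  rewrite /norm2 /nrm /norm2; congr Num.sqrt.
  rewrite -[RHS]mulr1 -uu /X /Y; ring.
have w0 t : 0 < norm2 (X t) (Y t) + Y t.
  rewrite lt_def; apply/andP; split; last first.
    have := norm2_ge_y (X t) (Y t); have := ler_norm (- Y t); rewrite normrN.
    by lra.
  apply/negP => /eqP h; apply: nray; exists t.
  exists (nrm (c t) / nrm q); first by rewrite divr_gt0.
  rewrite XY in h.
  have X0 : X t = 0.
    have := norm2_sqr (X t) (Y t); rewrite XY.
    have -> : nrm (c t) = - Y t by lra.
    rewrite sqrrN => e1; apply/eqP; rewrite -sqrf_eq0; apply/eqP; lra.
  have YE : nrm (c t) = (c t).1 * u1 + (c t).2 * u2 by move: h; rewrite /Y; lra.
  have XE : (c t).1 * u2 = (c t).2 * u1 by move: X0; rewrite /X; lra.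
  rewrite [LHS]surjective_pairing; congr pair.
    transitivity (nrm (c t) * u1); last by rewrite /u1; ring.
    have -> : (c t).1 = (c t).1 * u1 * u1 + ((c t).1 * u2) * u2 by rewrite -[LHS]mulr1 -uu; ring.
    by rewrite YE XE; ring.
  transitivity (nrm (c t) * u2); last by rewrite /u2; ring.
  have -> : (c t).2 = ((c t).2 * u1) * u1 + (c t).2 * u2 * u2 by rewrite -[LHS]mulr1 -uu; ring.
  by rewrite YE -XE; ring.
have dV t : (c t).2 != 0 -> der (fun u => clock (X u) (Y u)) t
    (1 + Num.sg (c t).2 * e *
      (sin (ang (c t)) * force f g (ang (c t)) (nrm (c t)) / nrm (c t))).
  move=> y0; have [dx dy] := traj_der y0.
  have dX := der_opp (der_sub (der_mul dx (der_cst u2 t)) (der_mul dy (der_cst u1 t))).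
  have dY := der_opp (der_add (der_mul dx (der_cst u1 t)) (der_mul dy (der_cst u2 t))).
  have r1 : 0 < norm2 (X t) (Y t) by rewrite XY.
  apply: (der_eq (der_clock dX dY r1 (w0 t))).
  rewrite XY /force nrm_sin// nrm_cos// sin_ang//.
  have := norm2_sqr (c t).1 (c t).2; rewrite -/(nrm (c t)).
  rewrite normrEsg /X /Y; have : Num.sg (c t).2 * Num.sg (c t).2 = 1.
    by rewrite -expr2 sqr_sg y0.
  have r0' : nrm (c t) != 0 by rewrite gt_eqF.
  move: r0'; set s := Num.sg _; set x := (c t).1; set y := (c t).2.
  set r := nrm _ => r0' s2 rr.
  transitivity ((u1 ^+ 2 + u2 ^+ 2) * (x ^+ 2 + y ^+ 2 +
      x * e * (f.[x] * y + s * g.[x])) / r ^+ 2).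
    by congr (_ / _); ring.
  rewrite uu mul1r -rr.
  transitivity (1 + x * e * ((s * s) * f.[x] * y + s * g.[x]) / r ^+ 2).
    by rewrite s2; field.
  by field.
have Vpos t : (c t).2 != 0 -> 0 < 1 + Num.sg (c t).2 * e *
      (sin (ang (c t)) * force f g (ang (c t)) (nrm (c t)) / nrm (c t)).
  move=> y0; have h := small t y0; set z := (X in 1 + _ * X).
  have : `|Num.sg (c t).2 * e * z| < 1.
    by rewrite 2!normrM normr_sg y0 mul1r.
  by rewrite ltr_norml => /andP[]; lra.
have [t0 y0] := traj_off_axis cT.
have Vc : continuous (fun u => clock (X u) (Y u)).
  by move=> t; apply: clock_cont; [exact: Xc|exact: Yc|exact: w0].
have := @lyapunov_pos _ f g e c T cT T0 _ _ Vc _ dV _ t0 y0.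
move=> h; have := Vpos t0 y0; rewrite h ?ltxx//.
  by move=> t; rewrite /X /Y cper.
by move=> t /Vpos/ltW.
Qed.

End Trajectory.
End Polar.

(** * Uniform Lipschitz estimates *)

Section UniformLipschitz.
Variables (R : realType) (P : Type) (D : set P) (r1 r2 : R).
Implicit Types h k : P -> R -> R.

(** Uniformity in the parameter [p] is what matters. The class is closed under
    the ring operations and under inverses, so estimates follow from the shape
    of a formula and no constant has to be computed. *)
Definition lipb h := exists2 C : R, 0 <= C & forall p, D p -> forall r s,
  r1 <= r <= r2 -> r1 <= s <= r2 ->
  `|h p r| <= C /\ `|h p r - h p s| <= C * `|r - s|.

Lemma lipb_ext h k :
  (forall p, D p -> forall r, r1 <= r <= r2 -> h p r = k p r) ->
  lipb h -> lipb k.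
Proof.
move=> hk [C C0 hC]; exists C => // p Dp r s rI sI.
by rewrite -!hk//; exact: hC.
Qed.

Lemma lipb_param (b : P -> R) (C : R) : (forall p, D p -> `|b p| <= C) ->
  lipb (fun p _ => b p).
Proof.
move=> bC; exists (Num.max C 0); first by rewrite le_max lexx orbT.
move=> p Dp r s _ _; rewrite subrr normr0 le_max bC//; split => //.
by rewrite mulr_ge0// le_max lexx orbT.
Qed.

Lemma lipb_cst (a : R) : lipb (fun _ _ => a).
Proof. exact: (@lipb_param _ `|a|). Qed.

Lemma lipb_id : lipb (fun _ r => r).
Proof.
exists (Num.max 1 (Num.max `|r1| `|r2|)); first by rewrite le_max ler01.
move=> p Dp r s /andP[h1 h2] _; split.
  have := ler_norm r2; have := ler_norm (- r1); rewrite normrN => h3 h4.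
  rewrite ler_norml !le_max.
  case: (leP 0 r) => r0.
    have h5 : r <= `|r2| by lra.
    rewrite h5 !orbT andbT.
    have : - Num.max 1 (Num.max `|r1| `|r2|) <= - 1 by rewrite lerN2 le_max lexx.
    by lra.
  rewrite (_ : r <= 1) ?andbT; last by lra.
  have : `|r1| <= Num.max 1 (Num.max `|r1| `|r2|) by rewrite !le_max lexx !orbT.
  by lra.
by rewrite ler_peMl// le_max lexx.
Qed.

Lemma lipb_add h k : lipb h -> lipb k -> lipb (fun p r => h p r + k p r).
Proof.
move=> [C C0 hC] [C' C'0 kC]; exists (C + C'); first exact: addr_ge0.
move=> p Dp r s rI sI; have [a1 a2] := hC p Dp r s rI sI.
have [b1 b2] := kC p Dp r s rI sI; split.
  by rewrite (le_trans (ler_normD _ _))// lerD.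
rewrite opprD addrACA (le_trans (ler_normD _ _))// mulrDl lerD//.
Qed.

Lemma lipb_mul h k : lipb h -> lipb k -> lipb (fun p r => h p r * k p r).
Proof.
move=> [C C0 hC] [C' C'0 kC]; exists (2 * (C * C')); first by rewrite !mulr_ge0.
move=> p Dp r s rI sI; have [a1 a2] := hC p Dp r s rI sI.
have [b1 b2] := kC p Dp r s rI sI; have [b3 _] := kC p Dp s s sI sI.
split.
  rewrite normrM (le_trans (ler_pM _ _ a1 b1))// ler_peMl ?mulr_ge0//; lra.
have -> : h p r * k p r - h p s * k p s =
   h p r * (k p r - k p s) + (h p r - h p s) * k p s by ring.
rewrite (le_trans (ler_normD _ _))// !normrM.
have e1 := ler_pM (normr_ge0 _) (normr_ge0 _) a1 b2.
have e2 := ler_pM (normr_ge0 _) (normr_ge0 _) a2 b3.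
by lra.
Qed.

Lemma lipb_opp h : lipb h -> lipb (fun p r => - h p r).
Proof.
move=> hh; apply: lipb_ext (lipb_mul (lipb_cst (-1)) hh) => p _ r _.
by rewrite mulN1r.
Qed.

Lemma lipb_inv h (m : R) : 0 < m ->
  (forall p, D p -> forall r, r1 <= r <= r2 -> m <= `|h p r|) ->
  lipb h -> lipb (fun p r => (h p r)^-1).
Proof.
move=> m0 hm [C C0 hC]; exists (m^-1 + C / m ^+ 2).
  by rewrite addr_ge0 ?divr_ge0 ?sqr_ge0// invr_ge0 ltW.
move=> p Dp r s rI sI; have [_ a2] := hC p Dp r s rI sI.
have hr := hm p Dp r rI; have hs := hm p Dp s sI.
have hr0 : h p r != 0 by rewrite -normr_gt0; lra.
have hs0 : h p s != 0 by rewrite -normr_gt0; lra.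
have Cm : 0 <= C / m ^+ 2 by rewrite divr_ge0 ?sqr_ge0.
have m10 : 0 < m^-1 by rewrite invr_gt0.
split.
  rewrite normfV (le_trans (_ : _ <= m^-1))//; last by lra.
  by rewrite lef_pV2// posrE//; lra.
have -> : (h p r)^-1 - (h p s)^-1 = (h p s - h p r) / (h p r * h p s).
  by field; apply/andP.
rewrite normrM normfV normrM distrC mulrDl.
apply: (@le_trans _ _ (C / m ^+ 2 * `|r - s|)); last first.
  by rewrite lerDr mulr_ge0// ltW.
have e1 : (`|h p r| * `|h p s|)^-1 <= (m ^+ 2)^-1.
  rewrite lef_pV2 ?posrE ?mulr_gt0 ?exprn_gt0//; try lra.
  by rewrite expr2 ler_pM// ltW.
have := ler_pM (normr_ge0 _) _ a2 e1.
rewrite invr_ge0 mulr_ge0// => /(_ isT) e2.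
by rewrite (le_trans e2)// mulrAC.
Qed.

Lemma lipb_horner (f : {poly R}) h : lipb h -> lipb (fun p r => f.[h p r]).
Proof.
move=> hh; elim/poly_ind: f => [|f a IH].
  by apply: lipb_ext (lipb_cst 0) => p _ r _; rewrite horner0.
apply: lipb_ext (lipb_add (lipb_mul IH hh) (lipb_cst a)) => p _ r _.
by rewrite hornerMXaddC.
Qed.

End UniformLipschitz.

Section Estimates.
Variables (R : realType) (f g : {poly R}).
Notation der f t d := (is_derive (t : R) (1 : R) (f : R -> R) (d : R)).

(** Along a trajectory on the side of sign s, r' = e * radial and
    a' = s (1 + s e * angular); with n = s e this gives dr/da = n * slope n. *)
Definition radial (a r : R) := - (cos a * force f g a r).
Definition angular (a r : R) := sin a * force f g a r / r.
Definition slope (n a r : R) := radial a r / (1 + n * angular a r).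

Definition force' (a r : R) :=
  f^`().[r * sin a] * sin a * (r * cos a) + f.[r * sin a] * cos a +
  g^`().[r * sin a] * sin a.
Definition radial' (a r : R) := - (cos a * force' a r).

Lemma der_radial a r : der (radial a) r (radial' a r).
Proof.
have d1 : der (fun r => r * sin a) r (sin a).
  by apply: (der_eq (der_mul (der_id r) (der_cst (sin a) r))); ring.
have d2 : der (fun r => r * cos a) r (cos a).
  by apply: (der_eq (der_mul (der_id r) (der_cst (cos a) r))); ring.
have df := @der_comp _ _ (fun r => r * sin a) r _ _ (is_derive_poly f (r * sin a)) d1.
have dg := @der_comp _ _ (fun r => r * sin a) r _ _ (is_derive_poly g (r * sin a)) d1.
apply: (der_eq (der_opp (der_scale (cos a) (der_add (der_mul df d2) dg)))).
by rewrite /radial' /force'.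
Qed.

Section Lip.
Variables (P : Type) (D : set P) (phi : P -> R) (r1 r2 : R).

Let lsin : lipb D r1 r2 (fun p _ => sin (phi p)).
Proof. by apply: (@lipb_param _ _ _ _ _ _ 1) => p _; exact: sin_max. Qed.

Let lcos : lipb D r1 r2 (fun p _ => cos (phi p)).
Proof. by apply: (@lipb_param _ _ _ _ _ _ 1) => p _; exact: cos_max. Qed.

Lemma lipb_force : lipb D r1 r2 (fun p r => force f g (phi p) r).
Proof.
have lid := @lipb_id R P D r1 r2.
have lx := lipb_mul lid lsin.
apply: lipb_add; last exact: lipb_horner.
by apply: lipb_mul; [exact: lipb_horner|exact: lipb_mul].
Qed.

Lemma lipb_radial : lipb D r1 r2 (fun p r => radial (phi p) r).
Proof. by apply: lipb_opp; apply: lipb_mul => //; exact: lipb_force. Qed.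

Lemma lipb_radial' : lipb D r1 r2 (fun p r => radial' (phi p) r).
Proof.
have lid := @lipb_id R P D r1 r2.
have lx := lipb_mul lid lsin.
apply: lipb_opp; apply: lipb_mul => //; apply: lipb_add; last first.
  by apply: lipb_mul => //; exact: lipb_horner.
apply: lipb_add; last by apply: lipb_mul => //; exact: lipb_horner.
apply: lipb_mul; last exact: lipb_mul.
by apply: lipb_mul => //; exact: lipb_horner.
Qed.

Lemma lipb_angular : 0 < r1 -> lipb D r1 r2 (fun p r => angular (phi p) r).
Proof.
move=> r10; apply: lipb_mul.
  by apply: lipb_mul => //; exact: lipb_force.
apply: (@lipb_inv _ _ _ _ _ _ r1) => //; last exact: lipb_id.
by move=> p _ r /andP[h _]; rewrite (le_trans h)// ler_norm.
Qed.

End Lip.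

(** One constant [C] for all radii in [[r1, r2]] and all [n] below [n0].
    [est_diffL] and [est_taylor] together say that differences of [slope] are,
    up to a small multiple of the difference of the radii, given by the
    derivative of [radial] at a fixed radius [q]. *)
Record estimates (r1 r2 C n0 : R) : Prop := Estimates {
  est_C : 0 < C; est_n : 0 < n0; est_nC : n0 * C <= 1 / 2;
  est_ang : forall a r, r1 <= r <= r2 -> `|angular a r| <= C;
  est_rad : forall a r, r1 <= r <= r2 -> `|radial a r| <= C;
  est_radL : forall a r s, r1 <= r <= r2 -> r1 <= s <= r2 ->
    `|radial a r - radial a s| <= C * `|r - s|;
  est_rad' : forall a r, r1 <= r <= r2 -> `|radial' a r| <= C;
  est_taylor : forall a q r s d, r1 <= q <= r2 -> r1 <= r <= r2 ->
    r1 <= s <= r2 -> `|r - q| <= d -> `|s - q| <= d ->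
    `|radial a r - radial a s - radial' a q * (r - s)| <= C * d * `|r - s|;
  est_slope : forall n a r, `|n| <= n0 -> r1 <= r <= r2 ->
    `|slope n a r| <= C;
  est_slopeL : forall n a r s, `|n| <= n0 -> r1 <= r <= r2 ->
    r1 <= s <= r2 -> `|slope n a r - slope n a s| <= C * `|r - s|;
  est_diff : forall n a r, `|n| <= n0 -> r1 <= r <= r2 ->
    `|slope n a r - radial a r| <= C * `|n|;
  est_diffL : forall n a r s, `|n| <= n0 -> r1 <= r <= r2 ->
    r1 <= s <= r2 -> `|slope n a r - slope n a s - (radial a r - radial a s)|
      <= C * `|n| * `|r - s| }.

Lemma estimates_ex (r1 r2 : R) : 0 < r1 ->
  exists C, exists2 n0, 0 < n0 & estimates r1 r2 C n0.
Proof.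
move=> r10.
have [Ca Ca0 hCa] := @lipb_angular R setT id r1 r2 r10.
have [Cr Cr0 hCr] := @lipb_radial R setT id r1 r2.
have [Cd Cd0 hCd] := @lipb_radial' R setT id r1 r2.
(* Keeps the denominator of [slope] above 1/2. *)
pose n1 := (2 * (Ca + 1))^-1.
have n10 : 0 < n1 by rewrite invr_gt0; lra.
have n1Ca : n1 * Ca <= 1 / 2.
  rewrite /n1 mulrC ler_pdivrMr; last by lra.
  lra.
pose D := [set p : R * R | `|p.2| <= n1].
have den p : D p -> forall r, r1 <= r <= r2 ->
    1 / 2 <= `|1 + p.2 * angular p.1 r|.
  move=> /= Dp r rI; have [h _] := hCa p.1 I r r rI rI.
  have : `|p.2 * angular p.1 r| <= 1 / 2.
    rewrite normrM; apply: le_trans n1Ca; exact: ler_pM.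
  rewrite ler_norml => /andP[h1 h2].
  by have := ler_norm (1 + p.2 * angular p.1 r); lra.
have lden : lipb D r1 r2 (fun p r => (1 + p.2 * angular p.1 r)^-1).
  apply: (@lipb_inv _ _ _ _ _ _ (1 / 2)); [by lra|exact: den|].
  apply: lipb_add; first exact: lipb_cst.
  apply: lipb_mul; last exact: lipb_angular.
  by apply: (@lipb_param _ _ _ _ _ _ n1).
have [Cs Cs0 hCs] : lipb D r1 r2 (fun p r => slope p.2 p.1 r).
  by apply: lipb_mul => //; exact: lipb_radial.
have [Cz Cz0 hCz] : lipb D r1 r2 (fun p r =>
    - (radial p.1 r * angular p.1 r / (1 + p.2 * angular p.1 r))).
  apply: lipb_opp; apply: lipb_mul => //; apply: lipb_mul.
    exact: lipb_radial.
  exact: lipb_angular.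
have zE n a r : `|n| <= n1 -> r1 <= r <= r2 -> slope n a r - radial a r =
    n * - (radial a r * angular a r / (1 + n * angular a r)).
  move=> hn rI; have := den (a, n) hn r rI; rewrite /= => h.
  have h0 : 1 + n * angular a r != 0 by rewrite -normr_gt0; lra.
  by rewrite /slope; field.
pose C := Ca + Cr + Cd + Cs + Cz + 1.
have C0 : 0 < C by rewrite /C; lra.
pose n0 := Num.min n1 (2 * C)^-1.
have n00 : 0 < n0.
  by rewrite lt_min n10 invr_gt0; lra.
have n0n1 (n : R) : `|n| <= n0 -> `|n| <= n1.
  by move=> h; rewrite (le_trans h)// ge_min lexx.
exists C, n0 => //; split => //.
- have h : n0 <= (2 * C)^-1 by rewrite ge_min lexx orbT.
  have : n0 * C <= (2 * C)^-1 * C by rewrite ler_pM2r.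
  by rewrite invfM -mulrA mulVf ?gt_eqF//; lra.
- by move=> a r rI; have [h _] := hCa a I r r rI rI; rewrite /C; lra.
- by move=> a r rI; have [h _] := hCr a I r r rI rI; rewrite /C; lra.
- move=> a r s rI sI; have [_ h] := hCr a I r s rI sI.
  by rewrite (le_trans h)// ler_wpM2r// /C; lra.
- by move=> a r rI; have [h _] := hCd a I r r rI rI; rewrite /C; lra.
- move=> a q r s d qI rI sI rq sq.
  wlog rs : r s rI sI rq sq / s <= r.
    move=> H; have [|/ltW] := leP s r; first exact: H.
    move=> /(H _ _ sI rI sq rq); rewrite [`|s - r|]distrC.
    congr (_ <= _); rewrite -normrN; congr `|_|; ring.
  rewrite [X in _ <= _ * X]ger0_norm ?subr_ge0//.
  have key : `|(radial a r - radial' a q * r) - (radial a s - radial' a q * s)|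
      <= C * d * (r - s).
    have d1 x : der (fun x => radial a x - radial' a q * x) x
        (radial' a x - radial' a q * 1).
      exact: (der_sub (der_radial a x) (der_scale _ (der_id x))).
    apply: (@mean_value_le _ _ (fun x => radial' a x - radial' a q * 1)) => //.
    + by move=> x _; exact: der_cont (d1 x).
    + move=> x /andP[sx xr]; rewrite mulr1.
      move: rI sI => /andP[rI1 rI2] /andP[sI1 sI2].
      have xI : r1 <= x <= r2.
        by rewrite (le_trans sI1 (ltW sx)) (le_trans (ltW xr) rI2).
      have [_ h] := hCd a I x q xI qI.
      rewrite (le_trans h)// ler_pM//; first by rewrite /C; lra.
      move: rq sq; rewrite !ler_distl => /andP[_ rq] /andP[sq _].
      by rewrite (le_trans sq (ltW sx)) (le_trans (ltW xr) rq).
  by apply: le_trans key; rewrite le_eqVlt; apply/orP; left;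
     apply/eqP; congr `|_|; ring.
- move=> n a r hn rI; have [h _] := hCs (a, n) (n0n1 n hn) r r rI rI.
  by rewrite /= in h; rewrite /C; lra.
- move=> n a r s hn rI sI; have [_ h] := hCs (a, n) (n0n1 n hn) r s rI sI.
  by rewrite (le_trans h)// ler_wpM2r// /C; lra.
- move=> n a r hn rI; rewrite zE ?n0n1// normrM mulrC ler_wpM2r//.
  have [h _] := hCz (a, n) (n0n1 n hn) r r rI rI.
  by rewrite /= in h; rewrite /C; lra.
- move=> n a r s hn rI sI; have [_ h] := hCz (a, n) (n0n1 n hn) r s rI sI.
  have -> : slope n a r - slope n a s - (radial a r - radial a s) =
    (slope n a r - radial a r) - (slope n a s - radial a s) by ring.
  rewrite !zE ?n0n1// -mulrBr normrM.
  have -> : C * `|n| * `|r - s| = `|n| * (C * `|r - s|) by ring.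
  apply: ler_wpM2l => //.
  by rewrite /= in h; rewrite (le_trans h)// ler_wpM2r// /C; lra.
Qed.

Section Continuity.
Variables (u v : R -> R) (t : R).
Hypotheses (uc : {for t, continuous u}) (vc : {for t, continuous v}).

Let sc : {for t, continuous (fun x => sin (u x))}.
Proof. exact: (cont_comp (@continuous_sin R _)). Qed.

Let cc : {for t, continuous (fun x => cos (u x))}.
Proof. exact: (cont_comp (@continuous_cos R _)). Qed.

Let pc (p : {poly R}) : {for t, continuous (fun x => p.[v x * sin (u x)])}.
Proof.
exact: (@cont_comp _ (horner p) _ _ (@continuous_horner _ p _) (cont_mul vc sc)).
Qed.

Lemma force_cont : {for t, continuous (fun x => force f g (u x) (v x))}.
Proof. by apply: cont_add; [apply: cont_mul; [|exact: cont_mul]|]; exact: pc. Qed.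

Lemma radial_cont : {for t, continuous (fun x => radial (u x) (v x))}.
Proof. by apply: cont_opp; apply: cont_mul => //; exact: force_cont. Qed.

Lemma angular_cont : v t != 0 ->
  {for t, continuous (fun x => angular (u x) (v x))}.
Proof.
by move=> v0; apply: cont_div => //; apply: cont_mul => //; exact: force_cont.
Qed.

End Continuity.

Lemma den_gt0 r1 r2 C n0 n a r : estimates r1 r2 C n0 -> `|n| <= n0 ->
  r1 <= r <= r2 -> 1 / 2 <= 1 + n * angular a r <= 3 / 2.
Proof.
move=> E hn rI; have h := est_ang E a rI.
have : `|n * angular a r| <= 1 / 2.
  by rewrite normrM; apply: le_trans (est_nC E); exact: ler_pM.
by rewrite ler_norml => /andP[h1 h2]; apply/andP; split; lra.
Qed.

End Estimates.

(** * Scalar differential equations *)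

Section Picard.
Variable R : realType.
Notation der f t d := (is_derive (t : R) (1 : R) (f : R -> R) (d : R)).

Lemma mean_value_ball (f df : R -> R) (x0 l K : R) :
  (forall x, `|x - x0| <= l -> der f x (df x) /\ `|df x| <= K) ->
  forall y, `|y - x0| <= l -> `|f y - f x0| <= K * `|y - x0|.
Proof.
move=> h y yl.
have fc x : `|x - x0| <= l -> {for x, continuous f}.
  by move=> /h[h1 _]; exact: der_cont h1.
have [xy|yx] := leP x0 y.
  rewrite ger0_norm ?subr_ge0// in yl *.
  have sub x : x0 <= x <= y -> `|x - x0| <= l.
    by move=> /andP[h1 h2]; rewrite ger0_norm ?subr_ge0//; lra.
  have sub' x : x0 < x < y -> `|x - x0| <= l.
    by move=> /andP[h1 h2]; apply: sub; rewrite !ltW.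
  apply: (@mean_value_le _ f df) => //.
  - by move=> x /sub/fc.
  - by move=> x /sub'/h[].
  - by move=> x /sub'/h[].
rewrite ltr0_norm ?subr_lt0// opprB in yl *.
have sub x : y <= x <= x0 -> `|x - x0| <= l.
  by move=> /andP[h1 h2]; rewrite ler0_norm ?subr_le0//; lra.
have sub' x : y < x < x0 -> `|x - x0| <= l.
  by move=> /andP[h1 h2]; apply: sub; rewrite !ltW.
rewrite distrC; apply: (@mean_value_le _ f df); first exact: ltW.
- by move=> x /sub/fc.
- by move=> x /sub'/h[].
- by move=> x /sub'/h[].
Qed.

Lemma half_pow_small (M d : R) : 0 < d -> exists n : nat, M / 2 ^+ n < d.
Proof.
move=> d0; exists (Num.bound `|M / d|).
set n := Num.bound _.
have h : `|M / d| < n%:R by exact: archi_boundP.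
have h2 : (n%:R : R) <= 2 ^+ n by rewrite -natrX ler_nat ltnW// ltn_expl.
rewrite ltr_pdivrMr ?exprn_gt0// mulrC -ltr_pdivrMr//.
by rewrite (le_lt_trans (ler_norm _))// (lt_le_trans h).
Qed.

Variables (F : R -> R -> R) (x0 l K L : R).
Hypotheses (l0 : 0 <= l) (Kl : K * l <= 1 / 2) (K0 : 0 <= K)
  (Fc : forall u, continuous u -> continuous (fun x => F x (u x)))
  (FK : forall x r s, `|F x r - F x s| <= K * `|r - s|)
  (FL : forall x r, `|F x r| <= L).

Let cl x := Num.max (x0 - l) (Num.min (x0 + l) x).

Let cl_in x : `|cl x - x0| <= l.
Proof.
rewrite /cl ler_norml; apply/andP; split.
  by rewrite lerBrDr le_max (addrC (- l)) lexx.
rewrite lerBlDr ge_max ge_min (addrC l) lexx /= andbT.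
by move: l0; lra.
Qed.

Let cl_id x : `|x - x0| <= l -> cl x = x.
Proof.
rewrite ler_norml => /andP[h1 h2]; rewrite /cl.
by rewrite min_r; [apply: max_r|]; lra.
Qed.

Let cl_cont : continuous cl.
Proof.
move=> x; apply: (@continuous_max _ _ (fun=> x0 - l)); first exact: cst_continuous.
by apply: (@continuous_min _ _ (fun=> x0 + l)); [exact: cst_continuous|exact: cvg_id].
Qed.

(** The iterates are frozen outside the interval by [cl], so that they are
    continuous on the whole line and the contraction by 1/2 holds there. With
    [e n] twice the next error, [v n - e n] increases and [v n + e n]
    decreases; the limit is the supremum of the former. *)
Theorem picard (a : R) : exists U : R -> R, [/\ U x0 = a, continuous U &
  forall x, `|x - x0| <= l -> der U x (F x (U x))].
Proof.
have ex (v : R -> R) : exists G : R -> R, continuous v ->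
    G x0 = a /\ forall x, der G x (F x (v x)).
  have [vc|nvc] := pselect (continuous v); last by exists v.
  have [G [_ dG]] := primitive (Fc vc).
  exists (fun x => G x + (a - G x0)) => _; split; first by ring.
  by move=> x; apply: (der_eq (der_add (dG x) (der_cst _ x))); rewrite addr0.
have [G hG] := choice ex.
pose T v x := G v (cl x).
have Tc v : continuous v -> continuous (T v).
  move=> /hG[_ dG] x; apply: (cont_comp _ (@cl_cont x)).
  exact: der_cont (dG _).
have contr v w d : continuous v -> continuous w ->
    (forall x, `|v x - w x| <= d) ->
    forall x, `|x - x0| <= l -> `|G v x - G w x| <= d / 2.
  move=> vc wc vw x xl.
  have [v0 dv] := hG v vc; have [w0 dw] := hG w wc.
  have := @mean_value_ball (fun x => G v x - G w x)
    (fun x => F x (v x) - F x (w x)) x0 l (K * d) _ x xl.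
  rewrite v0 w0 subrr subr0 => h.
  have d0 : 0 <= d by apply: le_trans (vw 0).
  apply: (le_trans (h _)).
    move=> y _; split; first exact: der_sub.
    by rewrite (le_trans (FK _ _ _))// ler_wpM2l.
  apply: (@le_trans _ _ (K * l * d)); last first.
    by rewrite mulrC ler_wpM2l//; move: Kl; lra.
  by rewrite mulrAC ler_wpM2r// ler_wpM2l.
pose v := fix v n := if n is n'.+1 then T (v n') else (fun=> a).
have vc n : continuous (v n).
  by elim: n => [|n IH] /=; [exact: cst_continuous|exact: Tc].
pose M := Num.max 0 (L * l).
have M0 : 0 <= M by rewrite le_max lexx.
have step n x : `|v n.+1 x - v n x| <= M / 2 ^+ n.
  elim: n x => [|n IH] x.
    rewrite expr0 divr1 /= /T.
    have [g0 dg] := hG _ (vc 0%N).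
    have := @mean_value_ball _ _ x0 l L (fun y _ => conj (dg y) (FL _ _)) (cl x) (cl_in x).
    rewrite g0 => /le_trans; apply; rewrite le_max; apply/orP; right.
    by rewrite ler_wpM2l// (le_trans _ (FL 0 0)).
  rewrite exprS invfM [2^-1 * _]mulrC mulrA.
  exact: (contr _ _ _ (vc n.+1) (vc n) IH (cl x) (cl_in x)).
pose e n := 2 * M / 2 ^+ n.
have eS n : e n.+1 + M / 2 ^+ n = e n.
  rewrite /e exprS; field; exact: expf_neq0.
have eS2 n : e n.+1 = M / 2 ^+ n.
  rewrite /e exprS; field; exact: expf_neq0.
have e0 n : 0 <= e n by rewrite /e divr_ge0 ?exprn_ge0// mulr_ge0.
have lowS x m n : (m <= n)%N -> v m x - e m <= v n x - e n.
  apply: (@homo_leq _ (fun n => v n x - e n) <=%R) => //; first exact: le_trans.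
  move=> {m}n; have a1 := eS n; have a2 := eS2 n.
  by have := step n x; rewrite ler_norml => /andP[h1 h2]; lra.
have upS x m n : (m <= n)%N -> v n x + e n <= v m x + e m.
  apply: (@homo_leq _ (fun n => v n x + e n) (fun a b => b <= a)) => //.
    by move=> p q r h1 h2; apply: le_trans h2 h1.
  move=> {m}n; have a1 := eS n; have a2 := eS2 n.
  by have := step n x; rewrite ler_norml => /andP[h1 h2]; lra.
have lowup x m n : v m x - e m <= v n x + e n.
  apply: (@le_trans _ _ (v (maxn m n) x - e (maxn m n))).
    by apply: lowS; rewrite leq_maxl.
  apply: (@le_trans _ _ (v (maxn m n) x + e (maxn m n))).
    by have := e0 (maxn m n); lra.
  by apply: upS; rewrite leq_maxr.
pose V x := sup [set v n x - e n | n in [set: nat]].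
have VE x n : `|V x - v n x| <= e n.
  rewrite ler_norml; apply/andP; split.
    suff : v n x - e n <= V x by lra.
    apply: ub_le_sup; last by exists n.
    by exists (v 0%N x + e 0%N) => _ [m _ <-].
  suff : V x <= v n x + e n by lra.
  apply: ge_sup; first by exists (v 0%N x - e 0%N), 0%N.
  by move=> _ [m _ <-].
have Vc : continuous V.
  move=> x; apply/cvgrPdist_lt => d d0.
  have d30 : 0 < d / 3 by lra.
  have [n hn] := half_pow_small (2 * M) d30.
  have := vc n x; move/cvgrPdist_lt => /(_ _ d30); apply: filterS => y h.
  have h1 := VE x n; have h2 := VE y n; rewrite /e in h1 h2.
  have -> : V x - V y = (V x - v n x) + (v n x - v n y) - (V y - v n y) by ring.
  apply: (le_lt_trans (ler_normB _ _)).
  have := ler_normD (V x - v n x) (v n x - v n y); lra.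
have [U0 dU] := hG V Vc.
have UV x : `|x - x0| <= l -> G V x = V x.
  move=> xl; apply/eqP; rewrite -subr_eq0 -normr_le0.
  apply/ler_addgt0Pr => d d0; rewrite add0r.
  have [n hn] := half_pow_small (2 * M) d0.
  have h1 := contr _ _ _ Vc (vc n) (fun y => VE y n) x xl.
  have h2 := VE x n.+1; rewrite /= /T cl_id// in h2.
  have := eS n; rewrite -eS2 => h3; rewrite -/(e n) in hn.
  have -> : G V x - V x = (G V x - G (v n) x) - (V x - G (v n) x) by ring.
  by apply: (le_trans (ler_normB _ _)); lra.
exists (G V); split => //.
- by move=> x; exact: der_cont (dU x).
- by move=> x xl; rewrite UV//; exact: dU.
Qed.

(** Where |U - W| is largest, the mean value inequality bounds it by its value
    at [x0] plus half of itself. *)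
Lemma picard_dep (U W : R -> R) :
  (forall x, `|x - x0| <= l -> der U x (F x (U x))) ->
  (forall x, `|x - x0| <= l -> der W x (F x (W x))) ->
  forall x, `|x - x0| <= l -> `|U x - W x| <= 2 * `|U x0 - W x0|.
Proof.
move=> dU dW.
have cN x : `|x - x0| <= l -> {for x, continuous (fun x => `|U x - W x|)}.
  move=> xl; apply: (@cont_comp _ (fun z => `|z|)); first exact: norm_continuous.
  by apply: cont_sub; [exact: der_cont (dU x xl)|exact: der_cont (dW x xl)].
have itvE x : (x0 - l <= x <= x0 + l) = (`|x - x0| <= l).
  by rewrite ler_norml; apply/idP/idP => /andP[h1 h2]; apply/andP; split; lra.
have [||c] := @EVT_max R (fun x => `|U x - W x|) (x0 - l) (x0 + l).
- by move: l0; lra.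
- by apply: cont_within => x; rewrite itvE; exact: cN.
rewrite in_itv /= itvE => cl' cmax.
set m := `|U c - W c| in cmax.
have h : `|(U c - W c) - (U x0 - W x0)| <= m / 2.
  apply: (le_trans (@mean_value_ball (fun x => U x - W x)
    (fun x => F x (U x) - F x (W x)) x0 l (K * m) _ c cl')).
    move=> x xl; split; first exact: (der_sub (dU x xl) (dW x xl)).
    rewrite (le_trans (FK _ _ _))// ler_wpM2l//.
    by apply: cmax; rewrite in_itv /= itvE.
  apply: (@le_trans _ _ (K * l * m)); last first.
    by rewrite mulrC ler_wpM2l ?normr_ge0//; move: Kl; lra.
  by rewrite mulrAC ler_wpM2r// ?normr_ge0// ler_wpM2l.
have h2 : m <= 2 * `|U x0 - W x0|.
  have := ler_normD (U c - W c - (U x0 - W x0)) (U x0 - W x0).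
  by rewrite subrK -/m; lra.
by move=> x xl; apply: le_trans h2; apply: cmax; rewrite in_itv /= itvE.
Qed.

End Picard.

(** * Half orbits and their displacement *)

Section HasIntegral.
Variable R : realType.
Notation der f t d := (is_derive (t : R) (1 : R) (f : R -> R) (d : R)).

(** The integral over [-pi/2, pi/2], through a primitive on the whole line. *)
Definition has_integral (h : R -> R) (A : R) :=
  exists2 G : R -> R, (forall x, der G x (h x)) &
    G (pi / 2) - G (- (pi / 2)) = A.

Lemma has_integral_ex h : continuous h -> exists A, has_integral h A.
Proof. by move=> /primitive[G [_ dG]]; exists (G (pi / 2) - G (- (pi / 2))), G. Qed.

Lemma has_integral0 : has_integral (fun=> 0) 0.
Proof. by exists (fun=> 0); [move=> x; exact: der_cst|rewrite subrr]. Qed.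

Lemma has_integral_add h k A B : has_integral h A -> has_integral k B ->
  has_integral (fun x => h x + k x) (A + B).
Proof.
move=> [G dG <-] [H dH <-]; exists (fun x => G x + H x); last by ring.
by move=> x; exact: der_add.
Qed.

Lemma has_integralZ a h A : has_integral h A ->
  has_integral (fun x => a * h x) (a * A).
Proof.
move=> [G dG <-]; exists (fun x => a * G x); last by ring.
by move=> x; exact: der_scale.
Qed.

Lemma has_integral_sum n (h : 'I_n -> R -> R) (A : 'I_n -> R) :
  (forall i, has_integral (h i) (A i)) ->
  has_integral (fun x => \sum_(i < n) h i x) (\sum_(i < n) A i).
Proof.
elim: n h A => [|n IH] h A hA.
  rewrite big_ord0; have := has_integral0; congr has_integral.
  by apply/funext => x; rewrite big_ord0.
rewrite big_ord_recr.
have := has_integral_add (IH _ _ (fun i => hA (widen_ord (leqnSn n) i))) (hA ord_max).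
by congr has_integral; apply/funext => x; rewrite big_ord_recr.
Qed.

(** Without its mean, a function has a primitive vanishing at both ends. Such a
    primitive, multiplied by the sign of y, is continuous across the axis and
    serves to average out the oscillation along an orbit. *)
Lemma has_integral_mean h A : has_integral h A ->
  exists B : R -> R, [/\ forall x, der B x (h x - A / pi),
    B (pi / 2) = 0 & B (- (pi / 2)) = 0].
Proof.
move=> [G dG <-{A}]; have p0 := pi_gt0 R.
set A := _ - _.
exists (fun x => G x - A / pi * x + (A / 2 - G (pi / 2))); split.
- move=> x; have h1 := der_scale (A / pi) (der_id x).
  apply: (der_eq (der_add (der_sub (dG x) h1) (der_cst _ x))).
  by rewrite mulr1 addr0.
- by rewrite mulrA divfK ?gt_eqF//; ring.
- rewrite mulrN mulrA divfK ?gt_eqF//.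
  by rewrite /A; field.
Qed.

End HasIntegral.

Section HalfSolutions.
Variables (R : realType) (f g : {poly R}) (q C n0 : R).
Hypotheses (q0 : 0 < q) (E : estimates f g (q / 2) (2 * q) C n0).
Notation der f t d := (is_derive (t : R) (1 : R) (f : R -> R) (d : R)).
Notation slope := (slope f g).
Notation radial := (radial f g).

(** Keeps the radius where the estimates hold, which makes the equation
    globally Lipschitz; the solutions that matter are never clamped. *)
Definition clampq (r : R) := Num.max (q / 2) (Num.min (2 * q) r).

Lemma clampq_in r : q / 2 <= clampq r <= 2 * q.
Proof.
rewrite /clampq le_max lexx /= ge_max ge_min lexx /= andbT.
by move: q0; lra.
Qed.

Lemma clampq_id r : q / 2 <= r <= 2 * q -> clampq r = r.
Proof. by move=> /andP[h1 h2]; rewrite /clampq min_r// max_r. Qed.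

Lemma clampq_cont : continuous clampq.
Proof.
move=> x; apply: (@continuous_max _ _ (fun=> q / 2)); first exact: cst_continuous.
by apply: (@continuous_min _ _ (fun=> 2 * q)); [exact: cst_continuous|exact: cvg_id].
Qed.

Lemma clampq_lip r s : `|clampq r - clampq s| <= `|r - s|.
Proof.
wlog rs : r s / s <= r.
  move=> H; have [|/ltW] := leP s r; first exact: H.
  by rewrite distrC (distrC r s); exact: H.
rewrite (ger0_norm (x := r - s)) ?subr_ge0// /clampq.
rewrite ler_norml; case: (leP (2 * q) r) => h1; case: (leP (2 * q) s) => h2;
 rewrite ?(max_r (x := q / 2) (y := 2 * q)); try (move: q0; lra);
 case: (leP (q / 2) r) => h3; case: (leP (q / 2) s) => h4;
 move: q0; lra.
Qed.

Lemma clamped_den n a r : `|n| <= n0 ->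
  1 / 2 <= 1 + n * angular f g a (clampq r) <= 3 / 2.
Proof. by move=> nn; exact: (den_gt0 _ E nn (clampq_in r)). Qed.

Lemma clamped_slope_cont n (u : R -> R) : `|n| <= n0 -> continuous u ->
  continuous (fun x => slope n x (clampq (u x))).
Proof.
move=> nn uc x.
have vc : {for x, continuous (fun x => clampq (u x))}.
  by apply: cont_comp; [exact: clampq_cont|exact: uc].
apply: (@cont_div _ (fun x => radial x (clampq (u x)))
  (fun x => 1 + n * angular f g x (clampq (u x)))).
- by apply: radial_cont => //; exact: cvg_id.
- apply: cont_add; first exact: cont_cst.
  apply: cont_mul; first exact: cont_cst.
  apply: (@angular_cont _ _ _ id (fun x => clampq (u x))) => //.
  by have /andP[h _] := clampq_in (u x); rewrite gt_eqF//; move: q0; lra.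
- by have /andP[h _] := clamped_den x (u x) nn; rewrite gt_eqF//; lra.
Qed.

(** The angles within 8 of the initial angle -pi/2 cover all values of [ang]. *)
Definition near_arc (x : R) := `|x - - (pi / 2)| <= 8.

Lemma ang_near_arc (p : R * R) : near_arc (ang p).
Proof.
rewrite /near_arc.
have := ang_bound p; have := pihalf_lt2 R; have := pi_gt0 R.
by rewrite ler_norml ltr_norml => h1 h2 /andP[h3 h4]; apply/andP; split; lra.
Qed.

Lemma half_pi_near_arc : near_arc (pi / 2).
Proof.
rewrite /near_arc.
by rewrite ger0_norm; [have := pihalf_lt2 R; lra|have := pi_gt0 R; lra].
Qed.

Section Fixed.
Variable n : R.
Hypothesis nn : `|n| <= n0 / 8.

Let nn0 : `|n| <= n0.
Proof. by have := est_n E; move: nn; lra. Qed.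

Let C0 := est_C E.

Let K8 : `|n| * C * 8 <= 1 / 2.
Proof.
apply: le_trans (est_nC E).
rewrite (_ : _ * 8 = `|n| * 8 * C); last by ring.
by rewrite ler_wpM2r ?(ltW C0)//; move: nn; lra.
Qed.

Let FL x r : `|n * slope n x (clampq r)| <= `|n| * C.
Proof. by rewrite normrM ler_wpM2l// (est_slope E)// clampq_in. Qed.

Let FK x r s : `|n * slope n x (clampq r) - n * slope n x (clampq s)| <=
  `|n| * C * `|r - s|.
Proof.
rewrite -mulrBr normrM -mulrA ler_wpM2l//.
apply: le_trans (est_slopeL E _ nn0 (clampq_in _) (clampq_in _)) _.
by rewrite ler_wpM2l ?(ltW C0)// clampq_lip.
Qed.

Definition clamped_solution (U : R -> R) := continuous U /\
  forall x, near_arc x -> der U x (n * slope n x (clampq (U x))).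

Lemma clamped_solution_ex a : exists U, U (- (pi / 2)) = a /\ clamped_solution U.
Proof.
have [//| | |U [Ua Uc dU]] := @picard R (fun x r => n * slope n x (clampq r))
    (- (pi / 2)) 8 (`|n| * C) (`|n| * C) _ K8 _ _ FK FL a.
- by rewrite mulr_ge0 ?(ltW C0).
- move=> u uc x.
  exact: (cont_mul (@cont_cst _ n x) (@clamped_slope_cont n u nn0 uc x)).
by exists U.
Qed.

Lemma clamped_solution_dep U W x : clamped_solution U -> clamped_solution W ->
  near_arc x -> `|U x - W x| <= 2 * `|U (- (pi / 2)) - W (- (pi / 2))|.
Proof.
move=> [_ dU] [_ dW].
apply: (@picard_dep R (fun x r => n * slope n x (clampq r))
    (- (pi / 2)) 8 (`|n| * C) _ K8 _ FK U W dU dW) => //.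
by rewrite mulr_ge0 ?(ltW C0).
Qed.

Lemma clamped_solution_drift U x : clamped_solution U -> near_arc x ->
  `|U x - U (- (pi / 2))| <= 8 * C * `|n|.
Proof.
move=> [_ dU] xl.
apply: (le_trans (@mean_value_ball _ _ _ _ 8 (`|n| * C)
  (fun y yl => conj (dU y yl) (FL _ _)) x xl)).
rewrite [leRHS](_ : _ = `|n| * C * 8); last by ring.
by rewrite ler_wpM2l// mulr_ge0 ?(ltW C0).
Qed.

(** The radius moves by O(n), so replacing [slope n] at the moving radius by
    [radial] at the initial radius costs O(n); the equation multiplies this
    error by n. *)
Lemma displacement U a A : clamped_solution U -> U (- (pi / 2)) = a ->
  q / 2 <= a <= 2 * q -> has_integral (radial^~ a) A ->
  `|U (pi / 2) - a - n * A| <= 8 * (C + 8 * C ^+ 2) * `|n| ^+ 2.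
Proof.
move=> Us Ua aI [G dG <-]; have [_ dU] := Us.
have := @mean_value_ball _ (fun x => U x - n * G x)
  (fun x => n * slope n x (clampq (U x)) - n * radial x a) (- (pi / 2)) 8
  (`|n| * (C * `|n| + C * (8 * C * `|n|))) _ (pi / 2) half_pi_near_arc.
move=> h; apply: (@le_trans _ _ (`|n| * (C * `|n| + C * (8 * C * `|n|)) * 8)).
  rewrite (_ : _ - n * _ = U (pi / 2) - n * G (pi / 2) -
    (U (- (pi / 2)) - n * G (- (pi / 2)))); last by rewrite Ua; ring.
  apply: (le_trans (h _)); last first.
    apply: ler_wpM2l; last exact: half_pi_near_arc.
    by rewrite mulr_ge0// addr_ge0 ?mulr_ge0 ?(ltW C0).
  move=> x xl; split; first exact: (der_sub (dU x xl) (der_scale n (dG x))).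
  rewrite -mulrBr normrM ler_wpM2l//.
  have -> : slope n x (clampq (U x)) - radial x a =
    slope n x (clampq (U x)) - radial x (clampq (U x)) +
    (radial x (clampq (U x)) - radial x a) by ring.
  apply: (le_trans (ler_normD _ _)); apply: lerD.
    exact: (est_diff E _ nn0 (clampq_in _)).
  apply: (le_trans (est_radL E _ (clampq_in _) aI)).
  rewrite ler_wpM2l ?(ltW C0)// -[X in _ - X](clampq_id aI).
  apply: (le_trans (clampq_lip _ _)).
  by rewrite -Ua; exact: clamped_solution_drift.
by rewrite le_eqVlt; apply/orP; left; apply/eqP; ring.
Qed.

End Fixed.

(** The gap at pi/2 between the half orbits for [e] and [- e] started at radius
    a is 2 e A + O(e^2), where A is the average of [radial] at radius a. It
    changes sign between [q - d] and [q + d] and is continuous in a. *)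
Lemma closing_solutions (d Am Ap : R) : 0 < d -> d <= q / 4 ->
  has_integral (radial^~ (q - d)) Am -> has_integral (radial^~ (q + d)) Ap ->
  Am * Ap < 0 ->
  exists2 n1, 0 < n1 & forall e, 0 < `|e| < n1 -> exists U W : R -> R,
    [/\ clamped_solution e U, clamped_solution (- e) W,
        U (- (pi / 2)) = W (- (pi / 2)), U (pi / 2) = W (pi / 2) &
        forall x, near_arc x -> `|U x - q| <= 2 * d /\ `|W x - q| <= 2 * d].
Proof.
move=> d0 dq hm hp AA; have C0 := est_C E; have n00 := est_n E.
have Am0 : Am != 0 by apply: contraTneq AA => ->; rewrite mul0r ltxx.
have Ap0 : Ap != 0 by apply: contraTneq AA => ->; rewrite mulr0 ltxx.
pose K := 8 * (C + 8 * C ^+ 2).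
have K0 : 0 < K by rewrite /K mulr_gt0// addr_gt0// mulr_gt0// exprn_gt0.
(* The drift stays below d, and the error K e^2 below the leading term of the
   gap at both initial radii. *)
pose n1 := Num.min (n0 / 8) (Num.min (d / (8 * C))
  (Num.min (`|Am| / K) (`|Ap| / K))).
have n10 : 0 < n1.
  by rewrite !lt_min !divr_gt0 ?normr_gt0// mulr_gt0.
exists n1 => // e /andP[e0]; rewrite !lt_min => /and4P[en ed eAm eAp].
have ne : `|e| <= n0 / 8 by exact: ltW.
have ne' : `|- e| <= n0 / 8 by rewrite normrN.
have [S hS] := choice (clamped_solution_ex ne).
have [S' hS'] := choice (clamped_solution_ex ne').
pose D a := S a (pi / 2) - S' a (pi / 2).
have hp2 := half_pi_near_arc.
have Dlip a b : `|D a - D b| <= 4 * `|a - b|.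
  have h1 := clamped_solution_dep ne (hS a).2 (hS b).2 hp2.
  have h2 := clamped_solution_dep ne' (hS' a).2 (hS' b).2 hp2.
  rewrite !(hS _).1 in h1; rewrite !(hS' _).1 in h2.
  rewrite (_ : D a - D b = (S a (pi / 2) - S b (pi / 2)) -
     (S' a (pi / 2) - S' b (pi / 2))); last by rewrite /D; ring.
  by apply: (le_trans (ler_normB _ _)); lra.
have Dc : continuous D.
  move=> a; apply/cvgrPdist_lt => z z0; exists (z / 4) => /=; first by lra.
  by move=> b /= ab; apply: (le_lt_trans (Dlip a b)); lra.
have Dsgn a A : q - d <= a <= q + d -> has_integral (radial^~ a) A ->
    A != 0 -> `|e| < `|A| / K -> 0 < (e * A) * D a.
  move=> aI hA A0 eA.
  have aI' : q / 2 <= a <= 2 * q.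
    by move: aI => /andP[h1 h2]; apply/andP; split; move: q0; lra.
  have h1 := displacement ne (hS a).2 (hS a).1 aI' hA.
  have h2 := displacement ne' (hS' a).2 (hS' a).1 aI' hA.
  rewrite -/K normrN in h1 h2; rewrite ltr_pdivlMr// in eA.
  have : `|D a - 2 * (e * A)| <= 2 * (K * `|e| ^+ 2).
    rewrite (_ : D a - _ = (S a (pi / 2) - a - e * A) -
      (S' a (pi / 2) - a - - e * A)); last by rewrite /D; ring.
    by apply: (le_trans (ler_normB _ _)); lra.
  have h3 : K * `|e| ^+ 2 < `|e * A|.
    by rewrite normrM expr2 mulrA mulrC ltr_pM2l// mulrC.
  rewrite ler_norml => /andP[h4 h5].
  have [ep|em|ez] := ltgtP (e * A) 0.
  - by rewrite (ltr0_norm ep) in h3; rewrite nmulr_rgt0//; lra.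
  - by rewrite (gtr0_norm em) in h3; rewrite pmulr_rgt0//; lra.
  - by move/eqP: ez; rewrite mulf_eq0 (negbTE A0) orbF -normr_eq0 gt_eqF.
have sm := @Dsgn (q - d) Am _ hm Am0 eAm.
have sp := @Dsgn (q + d) Ap _ hp Ap0 eAp.
have dN : - d <= d by apply/ltW/gtrN.
have {}sm : 0 < e * Am * D (q - d) by apply: sm; rewrite lexx lerD2l.
have {}sp : 0 < e * Ap * D (q + d) by apply: sp; rewrite lexx lerD2l dN.
have DD : D (q - d) * D (q + d) < 0.
  have h : 0 < (e ^+ 2 * (Am * Ap)) * (D (q - d) * D (q + d)).
    by have := mulr_gt0 sm sp; congr (0 < _); ring.
  have e2 : e ^+ 2 * (Am * Ap) < 0.
    by rewrite pmulr_rlt0// exprn_even_gt0//= -normr_gt0.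
  by move: h; rewrite nmulr_rgt0.
have [|||a] := @IVT R D (q - d) (q + d) 0.
- by lra.
- exact: continuous_subspaceT.
- rewrite ge_min le_max.
  have [h|h|h] := ltgtP (D (q - d)) 0.
  + by rewrite nmulr_rlt0// in DD; rewrite (ltW DD) orbT.
  + by rewrite pmulr_rlt0// in DD; rewrite (ltW DD) orbT.
  + by rewrite h mul0r ltxx in DD.
rewrite in_itv /= => aI Da.
exists (S a), (S' a); split.
- exact: (hS a).2.
- exact: (hS' a).2.
- by rewrite (hS a).1 (hS' a).1.
- by apply/eqP; rewrite -subr_eq0; apply/eqP.
move=> x xl.
have h1 := clamped_solution_drift ne (hS a).2 xl.
have h2 := clamped_solution_drift ne' (hS' a).2 xl.
rewrite (hS a).1 in h1; rewrite (hS' a).1 normrN in h2.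
have ed' : 8 * C * `|e| <= d.
  by rewrite mulrC -ler_pdivlMr ?mulr_gt0// ltW.
have aq : `|a - q| <= d.
  by rewrite ler_distl.
split.
  rewrite (_ : S a x - q = (S a x - a) + (a - q)); last by ring.
  by apply: (le_trans (ler_normD _ _)); lra.
rewrite (_ : S' a x - q = (S' a x - a) + (a - q)); last by ring.
by apply: (le_trans (ler_normD _ _)); lra.
Qed.

End HalfSolutions.

(** * Closed orbits from matching half orbits *)

Section Circle.
Variable R : realType.
Notation der f t d := (is_derive (t : R) (1 : R) (f : R -> R) (d : R)).

(** The triangular wave: its derivative is the sign of the cosine. *)
Definition fold (a : R) : R := ang (sin a, cos a).

Lemma norm2_sincos (a : R) : norm2 (sin a) (cos a) = 1.
Proof. by rewrite /norm2 addrC cos2Dsin2 sqrtr1. Qed.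

Lemma nrm_sincos (a : R) : nrm (sin a, cos a) = 1.
Proof. exact: norm2_sincos. Qed.

Lemma sin_fold (a : R) : sin (fold a) = sin a.
Proof. by rewrite /fold sin_ang nrm_sincos ?divr1. Qed.

Lemma cos_fold (a : R) : cos (fold a) = `|cos a|.
Proof. by rewrite /fold cos_ang nrm_sincos ?divr1. Qed.

Lemma fold_periodic (a : R) : fold (a + 2 * pi) = fold a.
Proof. by rewrite /fold mulrC mulr_natr sinD2pi cosD2pi. Qed.

Lemma fold_cont : continuous fold.
Proof.
move=> a; apply: (@clock_cont _ sin (fun x => `|cos x|)).
- exact: continuous_sin.
- apply: (@cont_comp _ (fun z => `|z|)); first exact: norm_continuous.
  exact: continuous_cos.
- by rewrite norm2_sym norm2_sincos ltr_pwDl.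
Qed.

Lemma der_fold (a : R) : cos a != 0 -> der fold a (Num.sg (cos a)).
Proof.
move=> c0.
have dY : der (fun x => `|cos x|) a (Num.sg (cos a) * - sin a).
  have h := sg_mul_der (@continuous_cos R a) c0 (is_derive_cos a).
  by apply: (der_near _ h); exists 1 => //= u _; rewrite normrEsg.
have n1 : norm2 (sin a) `|cos a| = 1 by rewrite norm2_sym norm2_sincos.
have := der_clock (is_derive_sin a) dY; rewrite n1 => /(_ ltr01).
move=> /(_ (ltr_pwDl ltr01 (normr_ge0 _))) h; apply: (der_eq h).
rewrite normrEsg expr1n divr1 -[RHS]mulr1 -(cos2Dsin2 a); ring.
Qed.

Lemma fold_axis (a : R) : cos a = 0 -> fold a = pi / 2 \/ fold a = - (pi / 2).
Proof. by move=> c0; apply: ang_axis; rewrite ?nrm_sincos. Qed.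

Lemma cos_leaves0 (a : R) : cos a = 0 -> \forall u \near a^'+, cos u != 0.
Proof.
move=> c0; exists pi; first exact: pi_gt0.
move=> u /= au ua; rewrite (_ : u = a + (u - a)); last by ring.
rewrite cosD c0 mul0r sub0r oppr_eq0 mulf_neq0//.
  by have := cos2Dsin2 a; rewrite c0; apply: contraPneq => ->; lra.
rewrite gt_eqF// sin_gt0_pi// subr_gt0 ua /=.
by move: au; rewrite distrC gtr0_norm// subr_gt0.
Qed.

Lemma polar_form (p : R * R) : exists a, p = (nrm p * sin a, nrm p * cos a).
Proof.
have [r0|r0] := ltP 0 (nrm p); last first.
  exists 0; have n0 : nrm p = 0 by apply: le_anti; rewrite r0 norm2_ge0.
  move: n0; have := norm2_sqr p.1 p.2; rewrite -/(nrm p) => + n0.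
  rewrite n0 !mul0r expr0n /= => /eqP; rewrite eq_sym paddr_eq0 ?sqr_ge0//.
  by rewrite !sqrf_eq0 => /andP[/eqP a1 /eqP a2]; rewrite (surjective_pairing p) a1 a2.
have [h|h] := leP 0 p.2.
  exists (ang p); rewrite nrm_sin// nrm_cos// ger0_norm//.
  exact: surjective_pairing.
exists (pi - ang p); rewrite sinB cosB sinpi cospi !mul0r sub0r addr0 !mulN1r opprK.
by rewrite mulrN nrm_sin// nrm_cos// ltr0_norm// opprK; exact: surjective_pairing.
Qed.

End Circle.

(** The identities by which a motion with r' = e * radial and angular speed w
    has the Cartesian velocity prescribed by the vector field; [S] is the side,
    [N] is |cos|. *)
Section Velocity.
Variables (R : realType) (e S N x w r co si : R).
Hypotheses (w0 : w != 0) (r0 : r != 0) (wE : w = 1 + S * e * (si * x / r))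
  (nE : N = S * co).

Lemma velocity_x : e * (- (N * x) / w) * w * si + r * (co * w) = r * co.
Proof.
transitivity (- e * N * x * si + r * co * w); first by field.
by rewrite wE nE; field.
Qed.

Lemma velocity_y F G : co ^+ 2 + si ^+ 2 = 1 -> S * S = 1 ->
  x = F * (r * N) + G ->
  e * (- (N * x) / w) * w * co + r * (- si * w) =
  - (r * si) - e * (F * (r * co) + S * G).
Proof.
move=> cs ss xE.
transitivity (- e * N * x * co - r * si * w); first by field.
transitivity (- (r * si) - S * e * x * (co ^+ 2 + si ^+ 2)).
  by rewrite wE nE; field.
rewrite cs mulr1 xE nE.
transitivity (- (r * si) - e * ((S * S) * F * (r * co) + S * G)); first by ring.
by rewrite ss mul1r.
Qed.

End Velocity.

Section ClosedOrbit.
Variables (R : realType) (f g : {poly R}) (q C n0 e d : R) (U W : R -> R).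
Hypotheses (q0 : 0 < q) (E : estimates f g (q / 2) (2 * q) C n0)
  (en : `|e| <= n0 / 8) (dq : d <= q / 4)
  (sU : clamped_solution f g q e U) (sW : clamped_solution f g q (- e) W)
  (UW1 : U (- (pi / 2)) = W (- (pi / 2))) (UW2 : U (pi / 2) = W (pi / 2))
  (UWd : forall x, near_arc x -> `|U x - q| <= 2 * d /\ `|W x - q| <= 2 * d).
Notation der f t d := (is_derive (t : R) (1 : R) (f : R -> R) (d : R)).
Notation slope := (slope f g).
Notation angular := (angular f g).
Notation radial := (radial f g).

(** [U] on the upper side and [W] on the lower one. *)
Definition radius (y a : R) : R :=
  (U a + W a) / 2 + Num.sg y * ((U a - W a) / 2).

Definition rad (p : R * R) : R := radius p.2 (ang p).

Lemma radius_pos y a : 0 < y -> radius y a = U a.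
Proof. by move=> y0; rewrite /radius gtr0_sg//; field. Qed.

Lemma radius_neg y a : y < 0 -> radius y a = W a.
Proof. by move=> y0; rewrite /radius ltr0_sg//; field. Qed.

Lemma radius_axis a : radius 0 a = (U a + W a) / 2.
Proof. by rewrite /radius sgr0 mul0r addr0. Qed.

Lemma radius_near y a : near_arc a -> `|radius y a - q| <= 2 * d.
Proof.
move=> /UWd[]; rewrite !ler_norml => /andP[h1 h2] /andP[h3 h4].
have [y0|y0|->] := ltgtP y 0.
- by rewrite radius_neg//; apply/andP.
- by rewrite radius_pos//; apply/andP.
- by rewrite radius_axis; apply/andP; split; lra.
Qed.

Lemma radius_in y a : near_arc a -> q / 2 <= radius y a <= 2 * q.
Proof.
move=> /(radius_near y); rewrite ler_norml => /andP[h1 h2].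
by apply/andP; split; move: q0 dq; lra.
Qed.

Lemma radius_gt0 y a : near_arc a -> 0 < radius y a.
Proof. by move=> /(radius_in y)/andP[h _]; move: q0; lra. Qed.

Lemma rad_in p : q / 2 <= rad p <= 2 * q.
Proof. exact/radius_in/ang_near_arc. Qed.

Lemma rad_gt0 p : 0 < rad p.
Proof. exact/radius_gt0/ang_near_arc. Qed.

Lemma radZ k p : 0 < k -> 0 < nrm p -> rad (k * p.1, k * p.2) = rad p.
Proof.
by move=> k0 p0; rewrite /rad angZ//= /radius sgrM gtr0_sg// mul1r.
Qed.

Lemma radius_cont (y a : R -> R) t : {for t, continuous y} ->
  {for t, continuous a} -> (y t = 0 -> a t = pi / 2 \/ a t = - (pi / 2)) ->
  {for t, continuous (fun u => radius (y u) (a u))}.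
Proof.
move=> yc ac ya.
have Uc : {for t, continuous (fun u => U (a u))}.
  by apply: cont_comp => //; exact: sU.1.
have Wc : {for t, continuous (fun u => W (a u))}.
  by apply: cont_comp => //; exact: sW.1.
apply: cont_add.
  by apply: cont_mul; [exact: cont_add|exact: cont_cst].
apply: sg_mul_continuous => //.
  by apply: cont_mul; [exact: cont_sub|exact: cont_cst].
by move=> /ya[] ->; rewrite (UW1, UW2) subrr mul0r.
Qed.

Lemma der_radius (y a : R -> R) t a' : {for t, continuous y} -> y t != 0 ->
  near_arc (a t) -> der a t a' ->
  der (fun u => radius (y u) (a u)) t
   (Num.sg (y t) * e * slope (Num.sg (y t) * e) (a t) (radius (y t) (a t)) * a').
Proof.
move=> yc y0 an da.
have dU := der_comp (sU.2 _ an) da; have dW := der_comp (sW.2 _ an) da.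
have d1 := der_mul (der_add dU dW) (der_cst 2^-1 t).
have d2 := sg_mul_der yc y0 (der_mul (der_sub dU dW) (der_cst 2^-1 t)).
apply: (der_eq (der_add d1 d2)).
have [y1|y1|y1] := ltgtP (y t) 0; last by rewrite y1 eqxx in y0.
  rewrite radius_neg// ltr0_sg// (clampq_id (r := W _)); last first.
    by rewrite -(radius_neg _ y1); exact: radius_in.
  by rewrite !mulN1r; field.
rewrite radius_pos// gtr0_sg// (clampq_id (r := U _)); last first.
  by rewrite -(radius_pos _ y1); exact: radius_in.
by rewrite !mul1r; field.
Qed.

Let en' : `|e| <= n0.
Proof. by have := est_n E; move: en; lra. Qed.

Let rho (a : R) := rad (sin a, cos a).

Let rho_gt0 a : 0 < rho a. Proof. exact: rad_gt0. Qed.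

Let rho_cont : continuous rho.
Proof.
move=> a; apply: (@radius_cont cos (@fold R)).
- exact: continuous_cos.
- exact: fold_cont.
- exact: fold_axis.
Qed.

Let sgsg (x : R) : x != 0 -> Num.sg x * Num.sg x = 1.
Proof. by move=> x0; rewrite -expr2 sqr_sg x0. Qed.

Let der_rho a : cos a != 0 ->
  der rho a (e * slope (Num.sg (cos a) * e) (fold a) (rho a)).
Proof.
move=> c0; have na : near_arc (fold a) by exact: ang_near_arc.
apply: (der_eq (der_radius (@continuous_cos R a) c0 na (der_fold c0))).
by rewrite /rho /rad -/(fold a) /=; rewrite mulrAC [_ * e * _]mulrAC sgsg// mul1r.
Qed.

(* The time per unit of angle on the upper and on the lower arc. *)
Let up a := (1 + e * angular a (clampq q (U a)))^-1.
Let dn a := (1 + - e * angular a (clampq q (W a)))^-1.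

Let speed_cont n (V : R -> R) : `|n| <= n0 -> continuous V ->
  continuous (fun a => (1 + n * angular a (clampq q (V a)))^-1).
Proof.
move=> nn Vc a.
have Dc : {for a, continuous (fun a => 1 + n * angular a (clampq q (V a)))}.
  apply: cont_add; first exact: cont_cst.
  apply: cont_mul; first exact: cont_cst.
  apply: (@angular_cont _ _ _ id (fun a => clampq q (V a))).
  - exact: cvg_id.
  - by apply: cont_comp; [exact: clampq_cont|exact: Vc].
  - by have /andP[h _] := clampq_in q0 (V a); rewrite gt_eqF//; move: q0; lra.
apply: cvgV => //.
by have /andP[h _] := clamped_den q0 E a (V a) nn; rewrite gt_eqF//; lra.
Qed.

Let upc : continuous up. Proof. exact: (speed_cont en' sU.1). Qed.
Let dnc : continuous dn.
Proof. by apply: (@speed_cont (- e) W); [rewrite normrN|exact: sW.1]. Qed.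

Let omega a := 1 + Num.sg (cos a) * e * angular (fold a) (rho a).

Let omega_bound a : 1 / 2 <= omega a <= 3 / 2.
Proof.
apply: (den_gt0 _ E); last exact: rad_in.
by rewrite normrM normr_sg; case: (cos a != 0); rewrite ?mul1r// mul0r ltW// (est_n E).
Qed.

Let halves (x y : R) : (x + y) / 2 + (x - y) / 2 * 1 = x /\
  (x + y) / 2 + (x - y) / 2 * -1 = y.
Proof. by split; field. Qed.

(** The time as a function of the unfolded angle has derivative 1/omega, which
    jumps at the axis. The half-sum of its two expressions is continuous; the
    half-difference comes with the sign of the cosine, which is the derivative
    of [fold], so it is the derivative of a smooth function of [fold a]. *)
Let time_ex : exists tau : R -> R, [/\ continuous tau,
   forall a, cos a != 0 -> der tau a (omega a)^-1 &
   exists T, forall a, tau (a + 2 * pi) = tau a + T].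
Proof.
have evc : continuous (fun a => (up (fold a) + dn (fold a)) / 2).
  apply: continuous_for => a; apply: cont_mul; last exact: cont_cst.
  apply: cont_add.
    by apply: cont_comp; [exact: upc|exact: fold_cont].
  by apply: cont_comp; [exact: dnc|exact: fold_cont].
have odc : continuous (fun a => (up a - dn a) / 2).
  apply: continuous_for => a; apply: cont_mul; last exact: cont_cst.
  by apply: cont_sub; [exact: upc|exact: dnc].
have [P [_ dP]] := primitive evc; have [Q [_ dQ]] := primitive odc.
exists (fun a => P a + Q (fold a)); split.
- apply: continuous_for => a; apply: cont_add; first exact: der_cont (dP a).
  by apply: cont_comp; [exact: der_cont (dQ _)|exact: fold_cont].
- move=> a c0; apply: (der_eq (der_add (dP a) (der_comp (dQ _) (der_fold c0)))).
  have na : near_arc (fold a) by exact: ang_near_arc.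
  have rI := radius_in (cos a) na.
  rewrite /omega /rho /rad /= -/(fold a) /up /dn.
  have [y1|y1|y1] := ltgtP (cos a) 0; last by rewrite y1 eqxx in c0.
    rewrite ltr0_sg//; rewrite radius_neg// in rI *.
    by rewrite (clampq_id rI) mulN1r (halves _ _).2.
  rewrite gtr0_sg//; rewrite radius_pos// in rI *.
  by rewrite (clampq_id rI) mul1r (halves _ _).1.
- exists (P (0 + 2 * pi) - P 0) => a.
  have dD t : der (fun x => P (x + 2 * pi) - P x) t 0.
    have h := @der_comp _ P (fun x => x + 2 * pi) t _ _ (dP (t + 2 * pi))
      (der_add (der_id t) (der_cst (2 * pi) t)).
    by apply: (der_eq (der_sub h (dP t))); rewrite !fold_periodic addr0 mulr1 subrr.
  have := der0_cst dD a 0.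
  by rewrite /= fold_periodic => <-; ring.
Qed.

(** The curve is run through with the angle [th t], where [th] is the inverse
    of the time function; th grows by 2 pi in the time [T]. Since the angle
    increases strictly, the axis is crossed in the right direction. *)
Theorem closed_orbit :
  periodic_orbit f g e [set p | 0 < nrm p /\ nrm p = rad p].
Proof.
have [tau [tauc dtau [T tauT]]] := time_ex.
have tau_mono a b : a <= b -> (b - a) / 2 <= tau b - tau a.
  move=> ab.
  have := @gate_nondecreasing R (fun x => tau x - x / 2) cos _ _ _ _ a b ab.
  move=> h; suff : tau a - a / 2 <= tau b - b / 2 by lra.
  apply: h.
  - apply: continuous_for => x; apply: cont_sub; first exact: tauc.
    by apply: (@cont_mul _ id (fun=> 2^-1)); [exact: cvg_id|exact: cont_cst].
  - exact: continuous_cos.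
  - move=> t c0; exists ((omega t)^-1 - (1 * 2^-1 + t * 0)).
      apply: der_sub; first exact: dtau.
      exact: (der_mul (der_id t) (der_cst _ t)).
    have /andP[h1 h2] := omega_bound t.
    have : (3 / 2)^-1 <= (omega t)^-1 by rewrite lef_pV2// posrE; lra.
    by rewrite invf_div; lra.
  - exact: cos_leaves0.
have tau_inj : injective tau.
  move=> a b ab; have [h|/ltW h] := leP a b.
    by have := tau_mono _ _ h; lra.
  by have := tau_mono _ _ h; lra.
have tau_surj t : exists a, tau a = t.
  pose b := 2 * (`|t| + `|tau 0|).
  have b0 : 0 <= b by rewrite mulr_ge0// addr_ge0.
  have [|||a _ ha] := @IVT R tau (- b) b t; last by exists a.
  - lra.
  - exact: continuous_subspaceT.
  - have h1 := tau_mono 0 b b0.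
    have h2 := tau_mono (- b) 0 ltac:(lra).
    have := ler_norm t; have := ler_norm (- t).
    have := ler_norm (tau 0); have := ler_norm (- tau 0); rewrite !normrN.
    by move=> h3 h4 h5 h6; rewrite ge_min le_max; apply/andP; split;
      apply/orP; [left|right]; rewrite /b in h1 h2; lra.
have [th thK] := choice tau_surj.
have tauK a : th (tau a) = a by apply: tau_inj; rewrite thK.
have th_lip s t : s <= t -> 0 <= th t - th s <= 2 * (t - s).
  move=> st; have [h|/ltW h] := leP (th s) (th t).
    by have := tau_mono _ _ h; rewrite !thK => h1; apply/andP; split; lra.
  by have := tau_mono _ _ h; rewrite !thK => h1; apply/andP; split; lra.
have th_lt s t : s < t -> th s < th t.
  move=> st; rewrite lt_def; have /andP[h _] := th_lip s t (ltW st).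
  rewrite -subr_ge0 h andbT; apply/eqP => e1.
  by have := thK t; rewrite e1 thK => e2; rewrite e2 ltxx in st.
have th_cont : continuous th.
  move=> t; apply/cvgrPdist_lt => z z0; exists (z / 2) => /=; first by lra.
  move=> s /= ts; have [h|/ltW h] := leP s t.
    have /andP[h1 h2] := th_lip s t h.
    by rewrite ger0_norm ?subr_ge0// in ts; rewrite ger0_norm//; lra.
  have /andP[h1 h2] := th_lip t s h.
  rewrite distrC ger0_norm//.
  by rewrite distrC ger0_norm ?subr_ge0// in ts; lra.
have T0 : 0 < T.
  have := tau_mono 0 (0 + 2 * pi); rewrite tauT => h.
  by have := pi_gt0 R => p0; have := h ltac:(lra); lra.
have thT t : th (t + T) = th t + 2 * pi.
  by apply: tau_inj; rewrite thK tauT thK.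
have der_th t : cos (th t) != 0 -> der th t (omega (th t)).
  move=> c0; have := @is_derive_inverse R tau th (omega (th t))^-1 (th t).
  rewrite thK invrK; apply.
  - by exists 1 => //= x _; exact: tauK.
  - by exists 1 => //= x _; exact: tauc.
  - exact: dtau.
  - have /andP[h _] := omega_bound (th t).
    by rewrite invr_eq0 gt_eqF//; lra.
pose c t := (rho (th t) * sin (th t), rho (th t) * cos (th t)).
have rtc : continuous (fun t => rho (th t)).
  by apply: continuous_for => t; apply: cont_comp; [exact: rho_cont|exact: th_cont].
have rT0 t : 0 < rho (th t) by exact: rho_gt0.
have angc t : ang (c t) = fold (th t).
  by rewrite /c (angZ (p := (sin (th t), cos (th t))))// nrm_sincos.
have sgc t : Num.sg (c t).2 = Num.sg (cos (th t)).
  by rewrite /= sgrM gtr0_sg// mul1r.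
have y0c t : ((c t).2 == 0) = (cos (th t) == 0).
  by rewrite mulf_eq0 gt_eqF.
have forceE t : force f g (fold (th t)) (rho (th t)) =
    f.[(c t).1] * (rho (th t) * `|cos (th t)|) + g.[(c t).1].
  by rewrite /force sin_fold cos_fold.
have traj : trajectory f g e c.
  split.
  - move=> t.
    have xc : {for t, continuous (fun t => rho (th t) * sin (th t))}.
      apply: cont_mul; first exact: rtc.
      by apply: cont_comp; [exact: continuous_sin|exact: th_cont].
    have yc : {for t, continuous (fun t => rho (th t) * cos (th t))}.
      apply: cont_mul; first exact: rtc.
      by apply: cont_comp; [exact: continuous_cos|exact: th_cont].
    exact: (cvg_pair xc yc).
  - move=> t; rewrite y0c sgc => c0.
    have dth := der_th t c0; have drh := der_comp (der_rho c0) dth.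
    have ds := der_comp (is_derive_sin (th t)) dth.
    have dc := der_comp (is_derive_cos (th t)) dth.
    have w0 : omega (th t) != 0.
      by have /andP[h _] := omega_bound (th t); rewrite gt_eqF//; lra.
    have slE : slope (Num.sg (cos (th t)) * e) (fold (th t)) (rho (th t)) =
      - (`|cos (th t)| * force f g (fold (th t)) (rho (th t))) / omega (th t).
      by rewrite /slope /radial cos_fold.
    have wE : omega (th t) = 1 + Num.sg (cos (th t)) * e *
      (sin (th t) * force f g (fold (th t)) (rho (th t)) / rho (th t)).
      by rewrite /omega /angular sin_fold.
    have r0 : rho (th t) != 0 by rewrite gt_eqF.
    have cs := cos2Dsin2 (th t); have ss := sgsg c0.
    have nE := normrEsg (cos (th t)).
    have frE := forceE t; rewrite -/(c t).
    rewrite slE in drh; split.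
      apply: (der_eq (der_mul drh ds)).
      exact: (velocity_x w0 r0 wE nE).
    apply: (der_eq (der_mul drh dc)).
    exact: (velocity_y w0 r0 wE nE cs ss frE).
  - move=> t /eqP; rewrite y0c => /eqP c0.
    have s2 : sin (th t) ^+ 2 = 1 by have := cos2Dsin2 (th t); rewrite c0; lra.
    have yE : (c t).2 = 0 by rewrite /= c0 mulr0.
    pose G := e * g.[(c t).1].
    pose r := rho (th t); pose s := sin (th t).
    have v1 : (vfield f g e 1 (c t)).2 = - (r * s) - G.
      by rewrite /vfield [LHS]/= c0 !mulr0 add0r mul1r.
    have v2 : (vfield f g e (-1) (c t)).2 = - (r * s) + G.
      by rewrite /vfield [LHS]/= c0 !mulr0 add0r mulN1r mulrN opprK.
    have Gr : `|G| < r.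
      have := est_ang E (fold (th t)) (rad_in (sin (th t), cos (th t))).
      rewrite -/(rho (th t)) /angular forceE c0 normr0 !mulr0 add0r sin_fold.
      rewrite normrM normfV normrM (gtr0_norm (rT0 t)).
      have -> : `|sin (th t)| = 1.
        by apply/eqP; rewrite -sqrp_eq1// -normrX s2 normr1.
      rewrite mul1r ler_pdivrMr// => h.
      rewrite /G normrM; apply: (le_lt_trans (ler_wpM2l (normr_ge0 e) h)).
      rewrite mulrA -[ltRHS]mul1r ltr_pM2r//.
      apply: (@le_lt_trans _ _ (n0 * C)); last by have := est_nC E; lra.
      by rewrite ler_wpM2r// ltW// (est_C E).
    have sgn : 0 < r + s * G.
      have : `|s * G| < r.
        rewrite normrM; have -> : `|s| = 1; last by rewrite mul1r.
        by apply/eqP; rewrite -sqrp_eq1// -normrX s2 normr1.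
      by rewrite ltr_norml => /andP[]; lra.
    have side u : (vfield f g e 1 (c t)).2 * (c u).2 =
       (r + s * G) * rho (th u) * sin (th u - th t).
      rewrite v1 [(c u).2]/=.
      have -> : cos (th u) = - (s * sin (th u - th t)).
        have {1}-> : th u = th t + (th u - th t) by ring.
        by rewrite cosD c0 mul0r sub0r.
      transitivity ((r * s ^+ 2 + s * G) * rho (th u) * sin (th u - th t)).
        by ring.
      by rewrite s2 mulr1.
    split.
    + split => //; rewrite v1 v2.
      have -> : (- (r * s) - G) * (- (r * s) + G) = r ^+ 2 * s ^+ 2 - G ^+ 2.
        by ring.
      rewrite s2 mulr1 subr_gt0 -[G ^+ 2]real_normK ?num_real//.
      have r0 := ltW (rT0 t).
      by rewrite ltr_pXn2r ?nnegrE ?normr_ge0.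
    + exists (pi / 2); first by rewrite /= divr_gt0// pi_gt0.
      move=> u /= tu ut; rewrite side.
      have /andP[_ h2] := th_lip u t (ltW ut); have h3 := th_lt u t ut.
      rewrite ger0_norm ?subr_ge0 ?ltW// in tu.
      have h : 0 < sin (th t - th u) by rewrite sin_gt0_pi//; apply/andP; split; lra.
      rewrite (_ : th u - th t = - (th t - th u)); last by ring.
      by rewrite sinN mulrN oppr_lt0 !mulr_gt0.
    + exists (pi / 2); first by rewrite /= divr_gt0// pi_gt0.
      move=> u /= tu ut; rewrite side.
      have /andP[_ h2] := th_lip t u (ltW ut); have h3 := th_lt t u ut.
      rewrite distrC ger0_norm ?subr_ge0 ?ltW// in tu.
      have h : 0 < sin (th u - th t) by rewrite sin_gt0_pi//; apply/andP; split; lra.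
      by rewrite !mulr_gt0.
exists c, T; split => //.
- move=> t; rewrite /c thT [2 * _]mulrC mulr_natr /rho.
  by rewrite sinD2pi cosD2pi.
- exists (tau (th 0 + pi)); rewrite /c tauK sinDpi cosDpi => -[h1 h2].
  have r1 := rho_gt0 (th 0 + pi); have r2 := rT0 0.
  have rr0 : rho (th 0 + pi) + rho (th 0) != 0 by rewrite gt_eqF// addr_gt0.
  have s0 : sin (th 0) = 0.
    by apply: (mulfI rr0); rewrite mulrDl -h1 mulrN mulr0 subrr.
  have c0 : cos (th 0) = 0.
    by apply: (mulfI rr0); rewrite mulrDl -h2 mulrN mulr0 subrr.
  by have := cos2Dsin2 (th 0); rewrite s0 c0; lra.
apply/seteqP; split => p /=.
  move=> [p0 pr]; have [a pE] := polar_form p.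
  exists (tau a) => //; rewrite /c tauK.
  have ra : rho a = nrm p.
    have := @radZ (nrm p) (sin a, cos a) p0; rewrite nrm_sincos => /(_ ltr01).
    by rewrite /= -pE -pr.
  by rewrite ra -pE.
move=> [t _ <-].
have nE : nrm (c t) = rho (th t).
  by rewrite -[RHS]mulr1 -(nrm_sincos (th t)) -nrmZ// ltW.
rewrite nE; split => //.
by rewrite (@radZ (rho (th t)) (sin (th t), cos (th t)))// nrm_sincos.
Qed.

End ClosedOrbit.

(** * Periodic orbits near a circle *)

Section NearCircle.
Variables (R : realType) (f g : {poly R}) (q C n0 e dl : R)
  (c : R -> R * R) (T : R).
Hypotheses (q0 : 0 < q) (E : estimates f g (q / 2) (2 * q) C n0)
  (en : `|e| <= n0) (dlq : dl <= q / 2)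
  (cT : trajectory f g e c) (T0 : 0 < T) (cper : forall t, c (t + T) = c t)
  (cdl : forall t, `|nrm (c t) - q| < dl).
Notation der f t d := (is_derive (t : R) (1 : R) (f : R -> R) (d : R)).
Notation slope := (slope f g).
Notation angular := (angular f g).
Notation radial := (radial f g).

Let r t := nrm (c t).
Let psi t := ang (c t).
Let s t := Num.sg (c t).2.
Let omega t := 1 + s t * e * angular (psi t) (r t).

Let rI t : q / 2 <= r t <= 2 * q.
Proof.
by have := cdl t; rewrite ltr_norml => /andP[h1 h2]; apply/andP; split;
   rewrite /r; move: q0 dlq; lra.
Qed.

Let r0 t : 0 < r t.
Proof. by have /andP[h _] := rI t; move: q0; lra. Qed.

Let sn t : `|s t * e| <= n0.
Proof.
rewrite normrM normr_sg; case: (_ != 0); first by rewrite mul1r.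
by rewrite mul0r ltW// (est_n E).
Qed.

Let omega_bound t : 1 / 2 <= omega t <= 3 / 2.
Proof. exact: (den_gt0 _ E). Qed.

Let ss t : (c t).2 != 0 -> s t * s t = 1.
Proof. by move=> y0; rewrite -expr2 sqr_sg y0. Qed.

Let der_r t : (c t).2 != 0 -> der r t (e * radial (psi t) (r t)).
Proof.
move=> y0; have [h _] := traj_polar cT y0.
by apply: (der_eq h); rewrite /Defs.vfield /radial; ring.
Qed.

Let der_psi t : (c t).2 != 0 -> der psi t (s t * omega t).
Proof. by move=> y0; have [_ h] := traj_polar cT y0; exact: (der_eq h). Qed.

Let r_cont : continuous r. Proof. exact: (traj_nrm_cont cT). Qed.

Let psi_cont : continuous psi.
Proof. by move=> t; apply: (traj_ang_cont cT); exact: r0. Qed.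

Let psi_axis t : (c t).2 = 0 -> psi t = pi / 2 \/ psi t = - (pi / 2).
Proof. by apply: ang_axis; exact: r0. Qed.

Lemma near_circle_meets_ray (p : R * R) : 0 < nrm p ->
  exists t, exists2 k : R, 0 < k & c t = (k * p.1, k * p.2).
Proof.
move=> p0; apply: (meets_ray cT T0 cper p0 r0) => t y0.
apply: (@le_lt_trans _ _ (n0 * C)); last by have := est_nC E; lra.
apply: ler_pM => //; exact: (est_ang E (psi t) (rI t)).
Qed.

Section Corrected.
(* A correction vanishing on the axis, so that it may change sign there. *)
Variables (B b : R -> R) (mu : R).
Hypotheses (dB : forall x, der B x (b x - mu)) (B1 : B (pi / 2) = 0)
  (B2 : B (- (pi / 2)) = 0).

Let corr t := s t * B (psi t).

Lemma corr_cont : continuous corr.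
Proof.
apply: continuous_for => t; apply: sg_mul_continuous.
- exact: (traj_y_cont cT).
- by apply: cont_comp; [exact: der_cont (dB _)|exact: psi_cont].
- by move=> /psi_axis[] ->.
Qed.

Lemma der_corr t : (c t).2 != 0 ->
  der corr t (omega t * (b (psi t) - mu)).
Proof.
move=> y0.
have h := sg_mul_der (traj_y_cont cT t) y0 (der_comp (dB _) (der_psi y0)).
apply: (der_eq h); rewrite -/(s t).
transitivity ((s t * s t) * omega t * (b (psi t) - mu)); first by ring.
by rewrite ss// mul1r.
Qed.

Lemma corr_bound K t : (forall x, `|b x - mu| <= K) -> `|corr t| <= K * 8.
Proof.
move=> bK.
have K0 : 0 <= K by apply: le_trans (bK 0).
have := @mean_value_ball _ B _ (- (pi / 2)) 8 K
  (fun x _ => conj (dB x) (bK x)) (psi t) (ang_near_arc (c t)).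
rewrite B2 subr0 => h.
rewrite normrM normr_sg; case: (_ != 0); last by rewrite mul0r mulr_ge0.
rewrite mul1r (le_trans h)// ler_wpM2l//; exact: ang_near_arc.
Qed.

End Corrected.

(** The radius, minus [e] times the correction made from [radial^~ q], has
    derivative e (A / pi + small), of constant sign. *)
Lemma no_orbit A : has_integral (radial^~ q) A -> A != 0 -> e != 0 ->
  C * dl + `|e| * C * (C + `|A / pi|) <= `|A / pi| / 2 -> False.
Proof.
move=> hA A0 e0 small; have C0 := est_C E.
have [W [dW W1 W2]] := has_integral_mean hA.
set mu := A / pi in dW small.
have mu0 : mu != 0 by rewrite mulf_neq0// invr_neq0// gt_eqF// pi_gt0.
have qI : q / 2 <= q <= 2 * q by apply/andP; split; move: q0; lra.
pose V t := r t - e * (s t * W (psi t)).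
pose D t := e * radial (psi t) (r t) -
   e * (omega t * (radial (psi t) q - mu)).
have dV t : (c t).2 != 0 -> der V t (D t).
  by move=> y0; apply: der_sub; [exact: der_r|apply: der_scale; exact: der_corr].
have Vc : continuous V.
  apply: continuous_for => t; apply: cont_sub; first exact: r_cont.
  by apply: cont_mul; [exact: cont_cst|exact: (corr_cont dW W1 W2)].
have VT t : V (t + T) = V t by rewrite /V /r /psi /s cper.
have Dpos t : 0 < (e * mu) * D t.
  have h1 : `|radial (psi t) (r t) - radial (psi t) q| <= C * dl.
    apply: le_trans (est_radL E _ (rI t) qI) _.
    by rewrite ler_wpM2l ?(ltW C0)//; exact: ltW (cdl t).
  have h2 : `|(omega t - 1) * (radial (psi t) q - mu)| <=
      `|e| * C * (C + `|mu|).
    rewrite normrM; apply: ler_pM => //.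
      rewrite /omega [1 + _]addrC addrK normrM; apply: ler_pM => //.
        rewrite normrM normr_sg -[leRHS]mul1r ler_wpM2r//.
        by case: (_ != 0); rewrite ?lexx ?ler01.
      exact: (est_ang E (psi t) (rI t)).
    apply: (le_trans (ler_normB _ _)).
    by rewrite lerD2r; exact: (est_rad E (psi t) qI).
  pose z := (radial (psi t) (r t) - radial (psi t) q) -
    (omega t - 1) * (radial (psi t) q - mu).
  have -> : e * mu * D t = e ^+ 2 * (mu * (mu + z)) by rewrite /D /z; ring.
  rewrite mulr_gt0 ?exprn_even_gt0//=.
  have : `|z| <= `|mu| / 2.
    by apply: (le_trans (ler_normB _ _)); lra.
  have [mp|mn|m0] := ltgtP mu 0; last by rewrite m0 eqxx in mu0.
    rewrite (ltr0_norm mp) ler_norml => /andP[h3 h4].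
    by rewrite nmulr_rgt0//; lra.
  rewrite (gtr0_norm mn) ler_norml => /andP[h3 h4].
  by rewrite pmulr_rgt0//; lra.
have [t y0] := traj_off_axis cT.
have em : e * mu != 0 by rewrite mulf_neq0.
have := lyapunov cT T0 em Vc VT dV (fun t _ => ltW (Dpos t)) y0.
by have := Dpos t => + D0; rewrite D0 mulr0 ltxx.
Qed.

Section Comparison.
Variables (d : R) (U W : R -> R).
Hypotheses (en8 : `|e| <= n0 / 8) (dq : d <= q / 4) (ddl : 2 * d <= dl)
  (sU : clamped_solution f g q e U) (sW : clamped_solution f g q (- e) W)
  (UW1 : U (- (pi / 2)) = W (- (pi / 2))) (UW2 : U (pi / 2) = W (pi / 2))
  (UWd : forall x, near_arc x -> `|U x - q| <= 2 * d /\ `|W x - q| <= 2 * d).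

(** Let w be the difference between the radius of the trajectory and that of
    the closed orbit at the same angle. Then w' is e * radial' * w up to a
    small multiple of e * w. The factor F corrects for the oscillation of [radial'] around
    its mean mu, and (w F)^2 has a derivative of the sign of e mu, which
    vanishes only with w. *)
Lemma on_closed_orbit A : has_integral (fun a => radial' f g a q) A ->
  A != 0 -> e != 0 ->
  let mu := `|A / pi| in let K := (C + mu) * 8 in
  C * `|e| + C * dl + `|e| * K * C <= mu / 2 -> `|e| * K <= 1 / 2 ->
  forall t, nrm (c t) = rad U W (c t).
Proof.
move=> hA A0 e0 m K small eK; have C0 := est_C E.
have [B [dB B1 B2]] := has_integral_mean hA.
set mu := A / pi in dB.
have mu0 : mu != 0 by rewrite mulf_neq0// invr_neq0// gt_eqF// pi_gt0.
have qI : q / 2 <= q <= 2 * q by apply/andP; split; move: q0; lra.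
pose rho t := radius U W (c t).2 (psi t).
have na t : near_arc (psi t) by exact: ang_near_arc.
have rhoI t : q / 2 <= rho t <= 2 * q := radius_in q0 dq UWd _ (na t).
have rhod t : `|rho t - q| <= dl.
  by apply: le_trans (radius_near UWd _ (na t)) ddl.
pose w t := r t - rho t.
pose F t := 1 - e * (s t * B (psi t)).
have FB t : `|e * (s t * B (psi t))| <= `|e| * K.
  rewrite normrM ler_wpM2l//; apply: (corr_bound dB B2) => x.
  by apply: (le_trans (ler_normB _ _)); rewrite lerD2r; exact: (est_rad' E x qI).
have wc : continuous w.
  apply: continuous_for => t; apply: cont_sub; first exact: r_cont.
  apply: (radius_cont sU sW UW1 UW2); first exact: (traj_y_cont cT).
    exact: psi_cont.
  exact: psi_axis.
have Fc : continuous F.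
  apply: continuous_for => t; apply: cont_sub; first exact: cont_cst.
  by apply: cont_mul; [exact: cont_cst|exact: (corr_cont dB B1 B2)].
pose S t := slope (s t * e) (psi t) (r t) - slope (s t * e) (psi t) (rho t).
have dw t : (c t).2 != 0 -> der w t (e * omega t * S t).
  move=> y0.
  have h := der_radius q0 dq sU sW UWd (traj_y_cont cT t) y0 (na t) (der_psi y0).
  apply: (der_eq (der_sub (der_r y0) h)).
  rewrite -/(s t) -/(rho t) /S.
  have w0 : omega t != 0 by have /andP[? _] := omega_bound t; rewrite gt_eqF//; lra.
  have -> : radial (psi t) (r t) = omega t * slope (s t * e) (psi t) (r t).
    by rewrite /slope -/(omega t) mulrC divfK.
  transitivity (e * omega t * slope (s t * e) (psi t) (r t) -
   (s t * s t) * e * omega t * slope (s t * e) (psi t) (rho t)); first by ring.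
  by rewrite ss//; ring.
have dF t : (c t).2 != 0 ->
    der F t (0 - e * (omega t * (radial' f g (psi t) q - mu))).
  by move=> y0; exact: (der_sub (der_cst 1 t) (der_scale e (der_corr dB y0))).
pose b t := radial' f g (psi t) q.
pose z t := (S t - b t * w t) - e * (s t * B (psi t)) * S t.
pose V t := (w t * F t) * (w t * F t).
pose D t := 2 * (w t * F t) * (e * omega t * (mu * w t + z t)).
have dV t : (c t).2 != 0 -> der V t (D t).
  move=> y0; have h := der_mul (dw t y0) (dF t y0).
  apply: (der_eq (der_mul h h)).
  by rewrite /D /z /F /b; ring.
have Vc : continuous V.
  apply: continuous_for => t.
  by apply: cont_mul; apply: cont_mul; [exact: wc|exact: Fc|exact: wc|exact: Fc].
have VT t : V (t + T) = V t by rewrite /V /w /F /rho /r /psi /s cper.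
have zb t : `|z t| <= `|mu| / 2 * `|w t|.
  have h1 : `|S t - (radial (psi t) (r t) - radial (psi t) (rho t))| <=
      C * `|e| * `|w t|.
    apply: le_trans (est_diffL E _ (sn t) (rI t) (rhoI t)) _.
    rewrite ler_wpM2r// ler_wpM2l ?(ltW C0)//.
    rewrite normrM normr_sg -[leRHS]mul1r ler_wpM2r//.
    by case: (_ != 0); rewrite ?lexx ?ler01.
  have h2 : `|radial (psi t) (r t) - radial (psi t) (rho t) - b t * w t| <=
      C * dl * `|w t|.
    by apply: (est_taylor E) => //; exact: ltW (cdl t).
  have h3 : `|e * (s t * B (psi t)) * S t| <= `|e| * K * C * `|w t|.
    rewrite normrM -[leRHS]mulrA; apply: ler_pM => //.
    exact: (est_slopeL E _ (sn t) (rI t) (rhoI t)).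
  have -> : z t = (S t - (radial (psi t) (r t) - radial (psi t) (rho t))) +
     (radial (psi t) (r t) - radial (psi t) (rho t) - b t * w t) -
     e * (s t * B (psi t)) * S t by rewrite /z; ring.
  apply: (le_trans (ler_normB _ _)).
  have h4 := ler_normD (S t - (radial (psi t) (r t) - radial (psi t) (rho t)))
     (radial (psi t) (r t) - radial (psi t) (rho t) - b t * w t).
  have h5 : (C * `|e| + C * dl + `|e| * K * C) * `|w t| <= m / 2 * `|w t|.
    by rewrite ler_wpM2r.
  rewrite !mulrDl in h5; rewrite -/m; lra.
have key t : mu ^+ 2 / 2 * w t ^+ 2 <= mu * w t * (mu * w t + z t).
  have : `|mu * w t * z t| <= mu ^+ 2 / 2 * w t ^+ 2.
    rewrite 2!normrM -[mu ^+ 2]real_normK ?num_real//.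
    rewrite -[w t ^+ 2]real_normK ?num_real//.
    rewrite (_ : `|mu| ^+ 2 / 2 * `|w t| ^+ 2 =
      `|mu| * `|w t| * (`|mu| / 2 * `|w t|)); last by ring.
    by rewrite ler_wpM2l// mulr_ge0.
  by rewrite ler_norml => /andP[h1 h2]; nra.
have Fpos t : 1 / 2 <= F t.
  have := le_trans (FB t) eK; rewrite ler_norml /F => /andP[h1 h2]; lra.
have DE t : e * mu * D t =
    2 * e ^+ 2 * F t * omega t * (mu * w t * (mu * w t + z t)).
  by rewrite /D; ring.
have fac t : 0 < 2 * e ^+ 2 * F t * omega t.
  have /andP[h _] := omega_bound t; have h2 := Fpos t.
  have e2 : 0 < e ^+ 2 by rewrite exprn_even_gt0.
  have half0 : 0 < 1 / 2 :> R by rewrite divr_gt0.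
  have F0 := lt_le_trans half0 h2; have om0 := lt_le_trans half0 h.
  by rewrite (mulr_gt0 (mulr_gt0 (mulr_gt0 _ e2) F0) om0).
have key0 t : 0 <= mu * w t * (mu * w t + z t).
  by apply: le_trans (key t); rewrite mulr_ge0 ?sqr_ge0// divr_ge0 ?sqr_ge0.
have Dpos t : (c t).2 != 0 -> 0 <= e * mu * D t.
  by move=> _; rewrite DE mulr_ge0// ltW.
have em : e * mu != 0 by rewrite mulf_neq0.
have w0 t : (c t).2 != 0 -> w t = 0.
  move=> y0; have D0 := lyapunov cT T0 em Vc VT dV Dpos y0.
  have /eqP := DE t; rewrite D0 mulr0 eq_sym mulf_eq0 gt_eqF//= => /eqP h.
  have := key t; rewrite h => h1; apply/eqP; rewrite -sqrf_eq0.
  rewrite -(mulrI_eq0 _ (mulfI (_ : mu ^+ 2 / 2 != 0))); last first.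
    by rewrite mulf_neq0 ?expf_neq0// invr_neq0.
  by rewrite eq_le h1 mulr_ge0 ?sqr_ge0// divr_ge0 ?sqr_ge0.
move=> t; apply/eqP; rewrite -subr_eq0; apply/negPn/negP => wt.
have [y0|y0] := eqVneq (c t).2 0; last first.
  by have := w0 t y0; move/eqP; rewrite (negbTE wt).
have ws := sg_near (wc t) wt.
near t^'+ => u.
have wu : w u = 0 by apply: w0; near: u; exact: (traj_leaves_axis cT).
have : Num.sg (w u) = Num.sg (w t).
  by near: u; rewrite near_withinE; apply: filterS ws.
by move/eqP; rewrite wu sgr0 eq_sym sgr_eq0 (negbTE wt).
Unshelve. all: by end_near.
Qed.

End Comparison.
End NearCircle.

(** * The local picture at a radius *)

(** [dl] measures the region of uniqueness and [d] the position of the orbit.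
    That [dl] can be kept while [d] and [e] tend to 0 is what identifies the
    orbits found for different [d] and makes them converge. *)
Definition only_orbit_near (R : realType) (f g : {poly R}) (q dl d e : R)
    (C : set (R * R)) : Prop :=
  [/\ periodic_orbit f g e C,
      forall p, C p -> `|nrm p - q| < d,
      forall p, 0 < nrm p -> exists2 k : R, 0 < k & C (k * p.1, k * p.2)
    & forall C', periodic_orbit f g e C' ->
        (forall p, C' p -> `|nrm p - q| < dl) -> C' = C].

Section Local.
Variables (R : realType) (f g M : {poly R}).
Hypotheses
  (HM : forall r, has_integral (fun a => radial f g a r) M.[r])
  (HM' : forall r, has_integral (fun a => radial' f g a r) M^`().[r]).

Lemma simple_root_sign (P : {poly R}) (q : R) : P.[q] = 0 -> P^`().[q] != 0 ->
  exists2 d0, 0 < d0 & forall d, 0 < d < d0 -> P.[q - d] * P.[q + d] < 0.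
Proof.
move=> /eqP/factor_theorem[Q PE] dP.
have Q0 : Q.[q] != 0.
  by move: dP; rewrite PE derivM derivXsubC hornerD !hornerM hornerXsubC subrr
    mulr0 add0r hornerC mulr1.
have [d0 /= d00 hd] := sg_near (@continuous_horner R Q q) Q0.
exists d0 => // d /andP[dp dd0].
have h1 : Num.sg Q.[q - d] = Num.sg Q.[q].
  by apply: hd; rewrite /ball_ /= opprB addrC subrK gtr0_norm.
have h2 : Num.sg Q.[q + d] = Num.sg Q.[q].
  by apply: hd; rewrite /ball_ /= opprD addrA subrr sub0r normrN gtr0_norm.
have : 0 < Q.[q - d] * Q.[q + d].
  by rewrite -sgr_gt0 sgrM h1 h2 -expr2 exprn_even_gt0//= sgr_eq0.
rewrite PE !hornerM !hornerXsubC => h.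
have -> : Q.[q - d] * (q - d - q) * (Q.[q + d] * (q + d - q)) =
  - (d ^+ 2 * (Q.[q - d] * Q.[q + d])) by ring.
by rewrite oppr_lt0 mulr_gt0 ?exprn_gt0.
Qed.

(** A simple root makes the average change sign, which gives the orbit, and
    makes the mean of [radial'] nonzero, which makes it unique. *)
Theorem simple_root_orbit (q : R) : 0 < q -> M.[q] = 0 -> M^`().[q] != 0 ->
  exists2 dl, 0 < dl & forall d', 0 < d' ->
  exists2 e1, 0 < e1 & forall e, 0 < `|e| < e1 ->
    exists C, only_orbit_near f g q dl d' e C.
Proof.
move=> q0 Mq dMq.
have [C [n0 n00 E]] := @estimates_ex R f g (q / 2) (2 * q) ltac:(lra).
have C0 := est_C E.
pose mu := `|M^`().[q] / pi|; pose K := (C + mu) * 8.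
have mu0 : 0 < mu.
  by rewrite normr_gt0 mulf_neq0// invr_neq0// gt_eqF// pi_gt0.
have K0 : 0 < K by rewrite /K; lra.
have [d0 d00 hd0] := simple_root_sign Mq dMq.
(* The linearization at q errs by at most mu / 4 within dl of q. *)
pose dl := Num.min (q / 2) (mu / 4 / C).
have dl0 : 0 < dl by rewrite lt_min !divr_gt0.
have dlq : dl <= q / 2 by rewrite ge_min lexx.
have Cdl : C * dl <= mu / 4.
  by rewrite mulrC -ler_pdivlMr// ge_min lexx orbT.
exists dl => // d' d'0.
(* The orbit will stay within 2 d of the circle. *)
pose d := Num.min (Num.min (q / 4) (d0 / 2)) (Num.min (dl / 2) (d' / 4)).
have dpos : 0 < d by rewrite !lt_min !divr_gt0.
have [dq dd0 ddl dd'] : [/\ d <= q / 4, d <= d0 / 2, d <= dl / 2 & d <= d' / 4].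
  by rewrite /d; split; rewrite !ge_min lexx ?orbT.
have dlt : 0 < d < d0 by apply/andP; split; lra.
have [n1 n10 close] := closing_solutions q0 E dpos dq
  (HM (q - d)) (HM (q + d)) (hd0 d dlt).
(* The last two bounds leave mu / 4 for the errors of order e and keep the
   correction factor above 1/2. *)
pose e1 := Num.min (Num.min n1 (n0 / 8))
  (Num.min (mu / 4 / (C + K * C)) (1 / 2 / K)).
have KC : 0 < C + K * C by rewrite addr_gt0// mulr_gt0.
have e10 : 0 < e1 by rewrite !lt_min n10 !divr_gt0//; lra.
exists e1 => // e /andP[epos]; rewrite !lt_min => /andP[/andP[en1 en8] /andP[eC eK]].
have e0 : e != 0 by rewrite -normr_gt0.
have en8' := ltW en8.
have en : `|e| <= n0.
  by apply: le_trans en8' _; rewrite ler_pdivrMr// ler_peMr ?ltW// ltr1n.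
have [U [W [sU sW UW1 UW2 UWd]]] := close e ltac:(by rewrite epos).
exists [set p | 0 < nrm p /\ nrm p = rad U W p]; split.
- exact: (closed_orbit q0 E en8' dq sU sW UW1 UW2 UWd).
- move=> p [_ ->].
  have := radius_near UWd p.2 (ang_near_arc p); rewrite -/(rad U W p) => h.
  by apply: (le_lt_trans h); lra.
- move=> p p0; have rp := rad_gt0 q0 dq UWd p.
  exists (rad U W p / nrm p); first exact: divr_gt0.
  rewrite /= nrmZ ?divr_ge0 ?ltW// radZ ?divr_gt0// divfK ?gt_eqF//.
move=> C' [c [T [cT T0 cper cnc ->]]] hC'.
have cdl t : `|nrm (c t) - q| < dl by apply: hC'; exists t.
have on t : nrm (c t) = rad U W (c t).
  apply: (on_closed_orbit q0 E en dlq cT T0 cper cdl dq _ sU sW UW1 UW2 UWd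
    (HM' q) dMq e0) => //.
  - by lra.
  - rewrite -/mu -/K -mulrA.
    have : `|e| * (C + K * C) <= mu / 4 by rewrite -ler_pdivlMr// ltW.
    by rewrite mulrDr; lra.
  - by rewrite -/mu -/K -ler_pdivlMr// ltW.
have cpos t : 0 < nrm (c t).
  by have := cdl t; rewrite ltr_norml => /andP[h1 h2]; lra.
apply/seteqP; split => p /=; first by move=> [t _ <-].
move=> [p0 pr].
have [t [k k0 ct]] := near_circle_meets_ray q0 E en dlq cT T0 cper cdl p0.
exists t => //.
have k1 : k = 1.
  have := on t; rewrite ct radZ// nrmZ ?ltW// -pr => h.
  by apply: (mulIf (_ : nrm p != 0)); rewrite ?gt_eqF// mul1r.
by rewrite ct k1 !mul1r -surjective_pairing.
Qed.

Theorem no_root_no_orbit (q : R) : 0 < q -> M.[q] != 0 ->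
  exists2 dl, 0 < dl & exists2 e1, 0 < e1 & forall e, 0 < `|e| < e1 ->
  forall C, periodic_orbit f g e C -> ~ (forall p, C p -> `|nrm p - q| < dl).
Proof.
move=> q0 Mq.
have [C [n0 n00 E]] := @estimates_ex R f g (q / 2) (2 * q) ltac:(lra).
have C0 := est_C E.
pose mu := `|M.[q] / pi|.
have mu0 : 0 < mu.
  by rewrite normr_gt0 mulf_neq0// invr_neq0// gt_eqF// pi_gt0.
pose dl := Num.min (q / 2) (mu / 4 / C).
have dl0 : 0 < dl by rewrite lt_min !divr_gt0.
have dlq : dl <= q / 2 by rewrite ge_min lexx.
have Cdl : C * dl <= mu / 4.
  by rewrite mulrC -ler_pdivlMr// ge_min lexx orbT.
exists dl => //; exists (mu / 4 / (C * (C + mu))).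
  by rewrite !divr_gt0// mulr_gt0// addr_gt0.
move=> e /andP[epos eC] C' [c [T [cT T0 cper _ ->]]] h.
have cdl t : `|nrm (c t) - q| < dl by apply: h; exists t.
have e0 : e != 0 by rewrite -normr_gt0.
have small : `|e| * (C * (C + mu)) <= mu / 4.
  by rewrite -ler_pdivlMr ?ltW// mulr_gt0// addr_gt0.
have := no_orbit q0 E dlq cT T0 cper cdl (HM q) Mq e0.
by apply; rewrite -/mu -[X in _ + X]mulrA; lra.
Qed.

End Local.

(** * Descartes's bound *)

Section Descartes.
Variable R : realType.
Implicit Types (p : {poly R}) (s : seq R).

(** [n] stands for a bound on the size, kept free for the inductions. *)
Definition nterms n p := count (fun k => p`_k != 0) (iota 0 n).

Lemma ntermsS n p :
  nterms n.+1 p = ((p`_0 != 0)%R + count (fun k => (p`_k.+1 != 0)%R) (iota 0 n))%N.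
Proof.
rewrite /nterms /= (iotaDl 1 0) count_map; congr (_ + _)%N.
Qed.

Lemma nterms_deriv n p :
  nterms n p^`() = count (fun k => p`_k.+1 != 0) (iota 0 n).
Proof.
apply: eq_count => k; rewrite coef_deriv.
by rewrite -mulr_natr mulf_eq0 pnatr_eq0 orbF.
Qed.

Lemma deriv0_const p : p^`() = 0 -> p = (p`_0)%:P.
Proof.
move=> p'0; apply/polyP => -[|k]; rewrite coefC//=.
have := congr1 (fun u : {poly R} => u`_k) p'0.
rewrite /= coef_deriv coef0 -mulr_natr => /eqP.
by rewrite mulf_eq0 pnatr_eq0 orbF => /eqP.
Qed.

Lemma drop1E p : p`_0 = 0 -> p = drop_poly 1 p * 'X.
Proof.
move=> p0; apply/polyP => -[|k]; rewrite coefMX//= coef_drop_poly addn1.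
by [].
Qed.

Lemma nterms_drop n p :
  nterms n (drop_poly 1 p) = count (fun k => p`_k.+1 != 0) (iota 0 n).
Proof. by apply: eq_count => k; rewrite coef_drop_poly addn1. Qed.

(** The last clause leaves room for counting a multiple root of [p] among the
    roots of the derivative. *)
Lemma rolle_path p x s : path <%R x s -> all (root p) (x :: s) ->
  exists t, [/\ size t = size s, path <%R x t, all (root p^`()) t &
    {in t, forall z, z \notin x :: s}].
Proof.
elim: s x => [|y s IH] x; first by move=> _ _; exists [::].
move=> /= /andP[xy ys] /andP[px pys].
have [t [st yt pt tys]] := IH y ys pys.
have [z /andP[xz zy] ez] := @mean_value _ (horner p) (horner p^`()) x y xy
  (fun u _ => @continuous_horner _ p u) (fun u _ => is_derive_poly p u).
have gt_y u : u \in t -> y < u.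
  by move: yt; rewrite (path_sortedE lt_trans) => /andP[/allP h _]; exact: h.
have ge_y u : u \in y :: s -> y <= u.
  rewrite inE => /orP[/eqP->//|us].
  by move: ys; rewrite (path_sortedE lt_trans) => /andP[/allP h _]; rewrite ltW// h.
exists (z :: t); split.
- by rewrite /= st.
- rewrite /= xz; move: yt; rewrite !(path_sortedE (@lt_trans _ R)) => /andP[h ->].
  by rewrite andbT; apply/allP => u /gt_y; exact: lt_trans.
- rewrite /= pt andbT; move: ez => /eqP.
  case/andP: pys => /eqP -> _; move/eqP: px => ->.
  by rewrite subrr eq_sym mulf_eq0 subr_eq0 (gt_eqF xy) orbF.
- move=> u; rewrite inE => /predU1P[->|ut].
    rewrite in_cons (gt_eqF xz) /=; apply/negP => /ge_y.
    by rewrite leNgt zy.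
  rewrite in_cons negb_or tys// andbT.
  by rewrite gt_eqF// (lt_trans xy)// gt_y.
Qed.

(** Dividing by 'X changes neither the number of terms nor the positive roots;
    when there is a constant term, differentiation removes it and loses at most
    one root by Rolle's theorem. *)
Lemma count_roots n p s : (size p <= n)%N -> p != 0 -> uniq s ->
  all (fun x => 0 < x) s -> all (root p) s -> (size s < nterms n p)%N.
Proof.
elim: n p s => [|n IH] p s pn p0 us spos sp.
  by move: pn; rewrite leqn0 size_poly_eq0 (negbTE p0).
rewrite ntermsS; have [c0|c0] := eqVneq p`_0 0.
  rewrite add0n -nterms_drop; have pE := drop1E c0.
  apply: IH => //.
  - by rewrite size_drop_poly leq_subLR add1n.
  - by apply: contraNneq p0 => h; rewrite pE h mul0r.
  - apply/allP => x xs; have /rootP := allP sp x xs.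
    rewrite {1}pE hornerMX => /eqP; rewrite mulf_eq0 => /orP[//|/eqP x0].
    by have := allP spos x xs; rewrite x0 ltxx.
rewrite add1n ltnS -nterms_deriv.
have [d0|d0] := eqVneq p^`() 0.
  case: s us spos sp => [//|x s] _ _ /andP[/rootP px _].
  by move: px; rewrite (deriv0_const d0) hornerC => h; rewrite h eqxx in c0.
have sz : (size p^`() <= n)%N.
  by rewrite -ltnS; apply: leq_trans pn; exact: lt_size_deriv.
have ss : sorted <%R (sort <=%R s) by rewrite lt_sorted_uniq_le sort_uniq us sort_le_sorted.
have sposs : all (fun x => 0 < x) (sort <=%R s) by rewrite all_sort.
have sps : all (root p) (sort <=%R s) by rewrite all_sort.
rewrite -(size_sort <=%R s).
case: (sort _ s) ss sposs sps => [//|x t] /= xt /andP[x0 _] pxt.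
have [u [<- xu pu _]] := rolle_path xt pxt.
apply: IH => //.
  by move: xu; rewrite (path_sortedE lt_trans) => /andP[_ /lt_sorted_uniq].
apply/allP => y yu; move: xu; rewrite (path_sortedE lt_trans) => /andP[/allP h _].
exact: lt_trans (h y yu).
Qed.

(** A double root is a root of the derivative in addition to those that come
    from Rolle's theorem. *)
Lemma count_roots_double n p s x0 : (size p <= n)%N -> p != 0 -> uniq s ->
  all (fun x => 0 < x) s -> all (root p) s -> x0 \in s -> root p^`() x0 ->
  ((size s).+1 < nterms n p)%N.
Proof.
elim: n p => [|n IH] p pn p0 us spos sp x0s px0.
  by move: pn; rewrite leqn0 size_poly_eq0 (negbTE p0).
rewrite ntermsS; have [c0|c0] := eqVneq p`_0 0.
  rewrite add0n -nterms_drop; have pE := drop1E c0.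
  have sq : all (root (drop_poly 1 p)) s.
    apply/allP => x xs; have /rootP := allP sp x xs.
    rewrite {1}pE hornerMX => /eqP; rewrite mulf_eq0 => /orP[//|/eqP x0'].
    by have := allP spos x xs; rewrite x0' ltxx.
  apply: IH => //.
  - by rewrite size_drop_poly leq_subLR add1n.
  - by apply: contraNneq p0 => h; rewrite pE h mul0r.
  - have /rootP h0 := allP sq x0 x0s.
    move/rootP: px0; rewrite {1}pE derivM derivX mulr1 hornerD hornerMX h0 addr0.
    move=> /eqP; rewrite mulf_eq0 => /orP[//|/eqP x0'].
    by have := allP spos x0 x0s; rewrite x0' ltxx.
rewrite add1n ltnS -nterms_deriv.
have [d0|d0] := eqVneq p^`() 0.
  have /rootP := allP sp x0 x0s.
  by rewrite (deriv0_const d0) hornerC => h; rewrite h eqxx in c0.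
have sz : (size p^`() <= n)%N.
  by rewrite -ltnS; apply: leq_trans pn; exact: lt_size_deriv.
have ss : sorted <%R (sort <=%R s) by rewrite lt_sorted_uniq_le sort_uniq us sort_le_sorted.
have sposs : all (fun x => 0 < x) (sort <=%R s) by rewrite all_sort.
have sps : all (root p) (sort <=%R s) by rewrite all_sort.
have x0s' : x0 \in sort <=%R s by rewrite mem_sort.
rewrite -(size_sort <=%R s).
case: (sort _ s) x0s' ss sposs sps => [//|x t] x0xt /= xt /andP[xp tpos] pxt.
have [u [szu xu pu uxt]] := rolle_path xt pxt.
have x0pos : 0 < x0.
  by move: x0xt; rewrite inE => /predU1P[->//|/(allP tpos)].
have -> : (size t).+1 = size (x0 :: u) by rewrite /= szu.
apply: count_roots => //=.
- apply/andP; split.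
    by apply/negP => /uxt; rewrite x0xt.
  by move: xu; rewrite (path_sortedE lt_trans) => /andP[_ /lt_sorted_uniq].
- rewrite x0pos /=; apply/allP => y yu.
  move: xu; rewrite (path_sortedE lt_trans) => /andP[/allP h _].
  exact: lt_trans (h y yu).
- by rewrite px0.
Qed.

End Descartes.

(** * Sparse polynomials and trigonometric moments *)

Section Sparse.
Variable R : realType.

Definition pts N : seq R := [seq (i.+1)%:R | i <- iota 0 N].

Lemma size_pts N : size (pts N) = N.
Proof. by rewrite size_map size_iota. Qed.

Lemma pts_uniq N : uniq (pts N).
Proof.
rewrite map_inj_uniq ?iota_uniq// => i j /eqP.
by rewrite eqr_nat eqSS => /eqP.
Qed.

Lemma pts_gt0 N : all (fun x => 0 < x) (pts N).
Proof. by apply/allP => _ /mapP[i _ ->]; rewrite ltr0n. Qed.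

(** Vanishing at N points is N conditions on N + 1 coefficients. A nonzero
    solution has N positive roots, hence N + 1 terms: no coefficient vanishes,
    and there is no room for another positive root or a double one. *)
Theorem sparse_poly (es : seq nat) N : uniq es -> size es = N.+1 ->
  exists P : {poly R}, [/\ forall k, (P`_k != 0) = (k \in es),
    forall x, 0 < x -> root P x = (x \in pts N)
    & forall x, x \in pts N -> P^`().[x] != 0].
Proof.
move=> ues ses.
pose A : 'M[R]_(N.+1, N) := \matrix_(i, j) (j.+1%:R ^+ nth 0%N es i).
have kA : kermx A != 0.
  rewrite kermx_eq0 /row_free; apply/negP => /eqP rA.
  by have := rank_leq_col A; rewrite rA ltnn.
pose v := nz_row (kermx A).
have v0 : v != 0 by rewrite nz_row_eq0.
have vA : v *m A = 0 by apply/sub_kermxP; exact: nz_row_sub.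
pose P : {poly R} := \sum_(i < N.+1) v 0 i *: 'X^(nth 0%N es i).
have Pin (i : 'I_N.+1) : P`_(nth 0%N es i) = v 0 i.
  rewrite coef_sum (bigD1 i)//= coefZ coefXn eqxx mulr1 big1 ?addr0// => j ji.
  rewrite coefZ coefXn nth_uniq ?ses// eq_sym.
  by rewrite (negbTE (_ : (j : nat) != i)) ?mulr0.
have Pout k : k \notin es -> P`_k = 0.
  move=> kes; rewrite coef_sum big1// => i _; rewrite coefZ coefXn.
  case: eqP => [kE|_]; last by rewrite mulr0.
  by move: kes; rewrite kE mem_nth// ses.
have P0 : P != 0.
  apply: contraNneq v0 => P0; apply/eqP/rowP => i.
  by rewrite -Pin P0 coef0 mxE.
have Proot : all (root P) (pts N).
  apply/allP => _ /mapP[j + ->]; rewrite mem_iota add0n /= => jN.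
  have := congr1 (fun B : 'M[R]_(1, N) => B 0 (Ordinal jN)) vA.
  rewrite /= !mxE => h; apply/rootP; rewrite -[RHS]h horner_sum.
  apply: eq_bigr => i _.
  by rewrite hornerZ hornerXn mxE.
pose n := size P; pose ts := [seq k <- iota 0 n | P`_k != 0].
have ts_es : {subset ts <= es}.
  move=> k; rewrite mem_filter => /andP[Pk _].
  by apply: contraNT Pk => /Pout ->.
have uts : uniq ts by rewrite filter_uniq ?iota_uniq.
have tsE : nterms n P = size ts by rewrite size_filter.
have tsN : (N < size ts)%N.
  have := count_roots (leqnn n) P0 (pts_uniq N) (pts_gt0 N) Proot.
  by rewrite size_pts tsE.
have szts : size ts = N.+1.
  by apply/eqP; rewrite eqn_leq tsN andbT -ses uniq_leq_size.
have [_ tsi] := uniq_min_size uts ts_es ltac:(by rewrite ses).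
exists P; split.
- move=> k; apply/idP/idP => [Pk|].
    by apply: contraNT Pk => /Pout ->.
  by rewrite -tsi mem_filter => /andP[].
- move=> x x0; apply/idP/idP => [Px|/(allP Proot)//].
  apply/negPn/negP => xN.
  have : (size (x :: pts N) < nterms n P)%N.
    apply: count_roots => //=; first by rewrite xN pts_uniq.
      by rewrite x0 pts_gt0.
    by rewrite Px.
  by rewrite /= size_pts tsE szts ltnn.
- move=> x xN; apply/negP => d0.
  have := count_roots_double (leqnn n) P0 (pts_uniq N) (pts_gt0 N) Proot xN d0.
  by rewrite size_pts tsE szts ltnn.
Qed.

End Sparse.

Section Moments.
Variable R : realType.
Notation der f t d := (is_derive (t : R) (1 : R) (f : R -> R) (d : R)).

Definition cs (i j : nat) (a : R) : R := cos a ^+ i * sin a ^+ j.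

Lemma cs_cont i j : continuous (cs i j).
Proof.
have powc (h : R -> R) n : continuous h -> continuous (fun a => h a ^+ n).
  move=> hc; apply: continuous_for => a.
  apply: (@cont_comp _ (fun z => z ^+ n)); last exact: hc.
  exact: exprn_continuous.
apply: continuous_for => a; apply: cont_mul.
  exact: (powc cos i (@continuous_cos R)).
exact: (powc sin j (@continuous_sin R)).
Qed.

(** The integrand is odd. *)
Lemma moment_odd i j A : odd j -> has_integral (cs i j) A -> A = 0.
Proof.
move=> jo [G dG <-].
have d0 x : der (fun x => G x - G (- x)) x 0.
  have h := @der_comp _ G (fun x => - x) x _ _ (dG (- x)) (der_opp (der_id x)).
  apply: (der_eq (der_sub (dG x) h)); rewrite /cs cosN sinN exprNn -signr_odd jo.
  by ring.
by have := der0_cst d0 (pi / 2) 0; rewrite oppr0 subrr.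
Qed.

(** The integrand is nonnegative, and positive inside the right half. *)
Lemma moment_even i j A : ~~ odd j -> has_integral (cs i j) A -> A != 0.
Proof.
move=> je [G dG <-]; have p0 := pi_gt0 R.
have Gc a b : a < b -> exists2 x, a < x < b & G b - G a = cs i j x * (b - a).
  move=> ab; apply: mean_value => //.
    by move=> x _; exact: der_cont (dG x).
have [x /andP[x0 xp] hx] := Gc 0 (pi / 2) ltac:(lra).
have [y /andP[yp y0] hy] := Gc (- (pi / 2)) 0 ltac:(lra).
have cx : 0 < cs i j x.
  rewrite mulr_gt0 ?exprn_gt0//.
    by rewrite cos_gt0_pihalf//; apply/andP; split; lra.
  by rewrite sin_gt0_pihalf// x0.
have cy : 0 <= cs i j y.
  apply: mulr_ge0; last exact: exprn_even_ge0.
  by rewrite exprn_ge0// ltW// cos_gt0_pihalf//; apply/andP; split; lra.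
have hx0 : 0 < G (pi / 2) - G 0 by rewrite hx mulr_gt0//; lra.
have hy0 : 0 <= G 0 - G (- (pi / 2)) by rewrite hy mulr_ge0//; lra.
by rewrite gt_eqF//; lra.
Qed.

Lemma moment_ex i : exists mom : nat -> R, forall j, has_integral (cs i j) (mom j).
Proof.
have ex j : exists A, has_integral (cs i j) A.
  by apply: has_integral_ex; exact: cs_cont.
by have [mom hm] := choice ex; exists mom.
Qed.

Variables (n m : nat) (u v : nat -> R).
Let f : {poly R} := \poly_(j < n) u j.
Let g : {poly R} := \poly_(j < m) v j.
Variables (mf mg : nat -> R).
Hypotheses (hf : forall j, has_integral (cs 2 j) (mf j))
  (hg : forall j, has_integral (cs 1 j) (mg j)).

(** As a polynomial in the radius, [radial] at the angle a is the case where
    the weights are the trigonometric monomials at a; its average over a is the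
    case where they are the moments. *)
Definition radial_poly (wf wg : nat -> R) : {poly R} :=
  \sum_(j < n) (wf j) *: (- u j *: 'X^(j.+1)) +
  \sum_(j < m) (wg j) *: (- v j *: 'X^j).

Lemma radialE a r : radial f g a r =
  (radial_poly (cs 2 ^~ a) (cs 1 ^~ a)).[r].
Proof.
rewrite /radial_poly hornerD !horner_sum /radial /force !horner_poly.
rewrite mulrDr opprD; congr (_ + _).
  rewrite mulr_suml mulr_sumr -sumrN; apply: eq_bigr => j _.
  by rewrite !hornerZ hornerXn /cs exprMn [r ^+ j.+1]exprS; ring.
rewrite mulr_sumr -sumrN; apply: eq_bigr => j _.
by rewrite !hornerZ hornerXn /cs exprMn expr1; ring.
Qed.

Lemma radial_linear (L : {poly R} -> R) (wf wg : nat -> R) :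
  (forall p q, L (p + q) = L p + L q) -> (forall k p, L (k *: p) = k * L p) ->
  L (radial_poly wf wg) =
  \sum_(j < n) wf j * L (- u j *: 'X^(j.+1)) +
  \sum_(j < m) wg j * L (- v j *: 'X^j).
Proof.
move=> LD LZ.
have L0 : L 0 = 0 by rewrite -(scale0r 0) LZ mul0r.
by rewrite LD !(big_morph L LD L0); congr (_ + _); apply: eq_bigr => j _; rewrite LZ.
Qed.

(** Used for the value and for the derivative at a radius. *)
Lemma radial_integral (L : {poly R} -> R) :
  (forall p q, L (p + q) = L p + L q) -> (forall k p, L (k *: p) = k * L p) ->
  has_integral (fun a => L (radial_poly (cs 2 ^~ a) (cs 1 ^~ a)))
    (L (radial_poly mf mg)).
Proof.
move=> LD LZ; rewrite (radial_linear _ _ LD LZ).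
have -> : (fun a => L (radial_poly (cs 2 ^~ a) (cs 1 ^~ a))) =
  (fun a => (\sum_(j < n) L (- u j *: 'X^(j.+1)) * cs 2 j a) +
            \sum_(j < m) L (- v j *: 'X^j) * cs 1 j a).
  apply/funext => a; rewrite (radial_linear _ _ LD LZ).
  by congr (_ + _); apply: eq_bigr => j _; rewrite mulrC.
apply: has_integral_add.
  under [X in has_integral _ X]eq_bigr do rewrite mulrC.
  by apply: has_integral_sum => j; exact: has_integralZ.
under [X in has_integral _ X]eq_bigr do rewrite mulrC.
by apply: has_integral_sum => j; exact: has_integralZ.
Qed.

Lemma integral_radial r :
  has_integral (fun a => radial f g a r) (radial_poly mf mg).[r].
Proof.
have -> : (fun a => radial f g a r) =
    (fun a => (radial_poly (cs 2 ^~ a) (cs 1 ^~ a)).[r]).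
  by apply/funext => a; exact: radialE.
apply: (radial_integral (L := fun p => p.[r])) => [p q|k p].
  by rewrite hornerD.
by rewrite hornerZ.
Qed.

Lemma integral_radial' r :
  has_integral (fun a => radial' f g a r) (radial_poly mf mg)^`().[r].
Proof.
have -> : (fun a => radial' f g a r) =
    (fun a => (radial_poly (cs 2 ^~ a) (cs 1 ^~ a))^`().[r]).
  apply/funext => a; apply: (der_unique (der_radial f g a r)).
  have -> : radial f g a = horner (radial_poly (cs 2 ^~ a) (cs 1 ^~ a)).
    by apply/funext => z; exact: radialE.
  exact: is_derive_poly.
apply: (radial_integral (L := fun p => p^`().[r])) => [p q|k p].
  by rewrite derivD hornerD.
by rewrite derivZ hornerZ.
Qed.

End Moments.

(** * Bifurcating families *)

Section Assembly.
Variable R : realType.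

(** The powers of the radius that survive averaging: odd ones from the even
    coefficients of f, even ones from the even coefficients of g. *)
Definition exps (n m : nat) : seq nat :=
  [seq i.*2.+1 | i <- iota 0 (n %/ 2).+1] ++ [seq i.*2 | i <- iota 0 (m %/ 2).+1].

Lemma exps_size n m : size (exps n m) = (n %/ 2 + m %/ 2 + 1).+1.
Proof. by rewrite size_cat !size_map !size_iota; lia. Qed.

Lemma exps_uniq n m : uniq (exps n m).
Proof.
have i1 : injective (fun i => i.*2.+1) by move=> i j /=; lia.
have i2 : injective double by move=> i j /=; lia.
rewrite cat_uniq (map_inj_uniq i1) (map_inj_uniq i2) !iota_uniq andbT andTb.
apply/hasPn => _ /mapP[i _ ->]; apply/mapP => -[j _] h.
by have := congr1 odd h; rewrite /= !odd_double.
Qed.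

Lemma mem_exps n m k : (k \in exps n m) =
  if odd k then (k <= n.+1)%N else (k <= m)%N.
Proof.
rewrite mem_cat; apply/idP/idP.
  move=> /orP[] /mapP[i]; rewrite mem_iota add0n /= => ik ->.
    by rewrite /= odd_double /=; lia.
  by rewrite odd_double; lia.
case: ifP => ok h; apply/orP; [left|right]; apply/mapP; exists k./2.
- by rewrite mem_iota add0n /=; lia.
- by lia.
- by rewrite mem_iota add0n /=; lia.
- by lia.
Qed.

(** Even moments are nonzero, so the even coefficients of f and g can be chosen
    to match the coefficients of a sparse polynomial. Odd moments vanish: the
    odd coefficients are free, and the value 1 gives the right degrees. *)
Theorem prescribed_average (n m : nat) : exists f g M : {poly R},
  [/\ size f = n.+1, size g = m.+1,
      forall r, has_integral (fun a => radial f g a r) M.[r],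
      forall r, has_integral (fun a => radial' f g a r) M^`().[r] &
      (forall x, 0 < x -> root M x = (x \in pts R (n %/ 2 + m %/ 2 + 1))) /\
      (forall x, x \in pts R (n %/ 2 + m %/ 2 + 1) -> M^`().[x] != 0)].
Proof.
have [P [Pc Pr Pd]] := sparse_poly R (exps_uniq n m) (exps_size n m).
have [mf hmf] := moment_ex R 2; have [mg hmg] := moment_ex R 1.
pose u j : R := if odd j then 1 else - P`_j.+1 / mf j.
pose v j : R := if odd j then 1 else - P`_j / mg j.
have MP : radial_poly n.+1 m.+1 u v mf mg = P.
  have -> : radial_poly n.+1 m.+1 u v mf mg =
     (\poly_(j < n.+1) (mf j * - u j)) * 'X + \poly_(j < m.+1) (mg j * - v j).
    rewrite /radial_poly !poly_def mulr_suml; congr (_ + _).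
      by apply: eq_bigr => j _; rewrite scalerA -scalerAl -exprSr.
    by apply: eq_bigr => j _; rewrite scalerA.
  have out k : k \notin exps n m -> P`_k = 0.
    by rewrite -Pc negbK => /eqP.
  apply/polyP => -[|k]; rewrite coefD coefMX !coef_poly /=.
    rewrite add0r /v /= mulNr opprK mulrC divfK//.
    exact: (moment_even _ (hmg 0%N)).
  rewrite /u /v /=; case: (boolP (odd k)) => ok /=.
    rewrite (moment_odd ok (hmf k)) mul0r if_same add0r.
    case: ifP => km; last by rewrite out// mem_exps /= ok /= -ltnS km.
    rewrite mulNr opprK mulrC divfK//.
    by apply: (moment_even _ (hmg k.+1)); rewrite /= negbK.
  have ok1 : odd k.+1 by rewrite /= ok.
  rewrite (moment_odd ok1 (hmg k.+1)) mul0r if_same addr0.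
  case: ifP => km; last by rewrite out// mem_exps /= ok /= km.
  by rewrite mulNr opprK mulrC divfK//; exact: (moment_even ok (hmf k)).
exists (\poly_(j < n.+1) u j), (\poly_(j < m.+1) v j), P; split.
- rewrite size_poly_eq// /u; case: (boolP (odd n)) => on; first exact: oner_neq0.
  rewrite mulf_neq0 ?oppr_eq0 ?invr_eq0 ?Pc ?mem_exps /= ?on//.
  exact: (moment_even on (hmf n)).
- rewrite size_poly_eq// /v; case: (boolP (odd m)) => om; first exact: oner_neq0.
  rewrite mulf_neq0 ?oppr_eq0 ?invr_eq0 ?Pc ?mem_exps /= ?(negbTE om)//.
  exact: (moment_even om (hmg m)).
- by move=> r; rewrite -MP; exact: integral_radial.
- by move=> r; rewrite -MP; exact: integral_radial'.
- by split.
Qed.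

Lemma nrm_lip (p q : R * R) : `|nrm p - nrm q| <= `|p.1 - q.1| + `|p.2 - q.2|.
Proof.
have le a b : nrm a <= nrm b + (`|a.1 - b.1| + `|a.2 - b.2|) :> R.
  have b0 : 0 <= nrm b := norm2_ge0 _ _.
  have s0 : 0 <= nrm b + (`|a.1 - b.1| + `|a.2 - b.2|) by rewrite !addr_ge0.
  rewrite -[leRHS]ger0_norm// -sqrtr_sqr ler_wsqrtr//.
  rewrite sqrrD norm2_sqr.
  have h1 := norm2_ge_x b.1 b.2; have h2 := norm2_ge_y b.1 b.2.
  rewrite -/(nrm b) in h1 h2.
  have e1 : a.1 ^+ 2 = b.1 ^+ 2 + 2 * (b.1 * (a.1 - b.1)) + `|a.1 - b.1| ^+ 2.
    by rewrite real_normK ?num_real//; ring.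
  have e2 : a.2 ^+ 2 = b.2 ^+ 2 + 2 * (b.2 * (a.2 - b.2)) + `|a.2 - b.2| ^+ 2.
    by rewrite real_normK ?num_real//; ring.
  have l1 : b.1 * (a.1 - b.1) <= nrm b * `|a.1 - b.1|.
    by apply: (le_trans (ler_norm _)); rewrite normrM ler_wpM2r.
  have l2 : b.2 * (a.2 - b.2) <= nrm b * `|a.2 - b.2|.
    by apply: (le_trans (ler_norm _)); rewrite normrM ler_wpM2r.
  have l3 : 0 <= `|a.1 - b.1| * `|a.2 - b.2| by rewrite mulr_ge0.
  rewrite e1 e2; set x := `|a.1 - b.1| in l1 l3 *; set y := `|a.2 - b.2| in l2 l3 *.
  have e3 : (x + y) ^+ 2 = x ^+ 2 + 2 * (x * y) + y ^+ 2 by ring.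
  have e4 : nrm b * (x + y) *+ 2 = 2 * (nrm b * x) + 2 * (nrm b * y) by ring.
  by rewrite e3 e4; lra.
have h1 := le p q; have h2 := le q p.
rewrite (distrC q.1) (distrC q.2) in h2.
by rewrite ler_norml; apply/andP; split; lra.
Qed.

Lemma nrm_continuous : continuous (fun p : R * R => nrm p).
Proof.
move=> p; apply: (@continuous_comp _ _ _
  (fun p : R * R => p.1 ^+ 2 + p.2 ^+ 2) Num.sqrt); last exact: sqrt_continuous.
by apply: cvgD; apply: cvgM; [exact: cvg_fst|exact: cvg_fst|exact: cvg_snd|exact: cvg_snd].
Qed.

Lemma annulus_open (q d : R) : open [set p : R * R | `|nrm p - q| < d].
Proof.
have -> : [set p : R * R | `|nrm p - q| < d] = (@nrm R) @^-1` ball q d.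
  by apply/seteqP; split => p /=; rewrite -ball_normE /ball_ /= distrC.
by apply: open_comp => [p _|]; [exact: nrm_continuous|exact: ball_open].
Qed.

Lemma circleE (r : R) p : 0 <= r -> circle r p <-> nrm p = r.
Proof.
move=> r0; rewrite /circle /= -norm2_sqr -/(nrm p).
by split=> [/eqP|-> //]; rewrite eqrXn2 ?norm2_ge0// => /eqP.
Qed.

Lemma scaled_close k (p : R * R) d : `|k * nrm p - nrm p| < d ->
  ball p d (k * p.1, k * p.2).
Proof.
have E (x : R) : `|x| <= nrm p -> `|x - k * x| <= `|k * nrm p - nrm p|.
  move=> xp; rewrite distrC.
  have -> : k * x - x = (k - 1) * x by ring.
  have -> : k * nrm p - nrm p = (k - 1) * nrm p by ring.
  rewrite !normrM ler_wpM2l// (ger0_norm (norm2_ge0 _ _)).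
  exact: xp.
move=> h; split; rewrite -ball_normE /ball_ /=.
  by apply: le_lt_trans h; apply: E; exact: norm2_ge_x.
by apply: le_lt_trans h; apply: E; exact: norm2_ge_y.
Qed.

Lemma tends_to_annulus (G : R -> set (R * R)) (q d : R) : 0 < q -> 0 < d ->
  tends_to G (circle q) ->
  \forall e \near (0 : R)^', forall p, G e p -> `|nrm p - q| < d.
Proof.
move=> q0 d0 Gt; have d20 : 0 < d / 2 by lra.
apply: filterS (Gt _ d20) => e [h _] p Gp.
have [z /(circleE _ (ltW q0)) <- [b1 b2]] := h p Gp.
apply: (le_lt_trans (nrm_lip _ _)).
move: b1 b2; rewrite -ball_normE /ball_ /= => b1 b2.
by rewrite distrC (distrC p.2); lra.
Qed.

Lemma punctured_near (e0 : R) : 0 < e0 ->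
  \forall e \near (0 : R)^', 0 < `|e| < e0.
Proof.
move=> e00; exists e0 => //= e /=; rewrite sub0r normrN => h1 h2.
by rewrite normr_gt0 h2.
Qed.

Lemma common_lower_bound N (F : 'I_N -> R) : (forall i, 0 < F i) ->
  exists2 e, 0 < e & forall i, e <= F i.
Proof.
elim: N F => [|N IH] F Fp; first by exists 1 => // -[].
have [e e0 he] := IH (fun i => F (lift ord0 i)) (fun i => Fp _).
exists (Num.min e (F ord0)); first by rewrite lt_min e0 Fp.
move=> i; rewrite ge_min; case: (unliftP ord0 i) => [j|] ->.
  by rewrite he.
by rewrite lexx orbT.
Qed.

Section Families.
Variables (f g M : {poly R}) (N : nat).
Hypotheses
  (HM : forall r, has_integral (fun a => radial f g a r) M.[r])
  (HM' : forall r, has_integral (fun a => radial' f g a r) M^`().[r])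
  (Mroot : forall x, 0 < x -> root M x = (x \in pts R N))
  (Msimple : forall x, x \in pts R N -> M^`().[x] != 0).

(** One family for each of the radii 1, ..., N. The bound 1/4 separates the
    families; letting it shrink, uniqueness shows that the orbit already chosen
    tends to the circle. *)
Lemma families_exist : exists (e0 : R) (G : 'I_N -> R -> set (R * R)),
  0 < e0 /\ distinct_bifurcating f g e0 G.
Proof.
pose q (i : 'I_N) : R := i.+1%:R.
have q0 i : 0 < q i by rewrite ltr0n.
have qN i : q i \in pts R N.
  by apply/mapP; exists (i : nat) => //; rewrite mem_iota add0n /=.
have orb i := simple_root_orbit HM HM' (q0 i)
  (rootP (etrans (Mroot (q0 i)) (qN i))) (Msimple (qN i)).
have ex1 i : exists dl, 0 < dl /\ forall d, 0 < d ->
    exists2 e1, 0 < e1 & forall e, 0 < `|e| < e1 ->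
      exists C, only_orbit_near f g (q i) dl d e C.
  by have [dl h1 h2] := orb i; exists dl.
have [dl hdl] := choice ex1.
have dlm i : 0 < Num.min (dl i) (1 / 4).
  by rewrite lt_min (hdl i).1; lra.
have ex2 i : exists e1, 0 < e1 /\ forall e, 0 < `|e| < e1 ->
    exists C, only_orbit_near f g (q i) (dl i) (Num.min (dl i) (1 / 4)) e C.
  by have [e1 h1 h2] := (hdl i).2 _ (dlm i); exists e1.
have [e1 he1] := choice ex2.
have [e0 e00 he0] := common_lower_bound (fun i => (he1 i).1).
have ex3 (ie : 'I_N * R) : exists C, 0 < `|ie.2| < e0 ->
    only_orbit_near f g (q ie.1) (dl ie.1) (Num.min (dl ie.1) (1 / 4)) ie.2 C.
  case: ie => i e /=.
  have [ee|ne] := boolP (0 < `|e| < e0); last by exists set0.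
  have [|C hC] := (he1 i).2 e; last by exists C.
  by move: ee => /andP[-> h] /=; exact: lt_le_trans (he0 i).
have [G hG] := choice ex3.
have {}hG i e : 0 < `|e| < e0 ->
    only_orbit_near f g (q i) (dl i) (Num.min (dl i) (1 / 4)) e (G (i, e)).
  exact: (hG (i, e)).
exists e0, (fun i e => G (i, e)); split=> //; split=> [i|e ee i j ij GG].
  split=> [e ee|].
    have [Gp Gn _ Gu] := hG i e ee; split=> //.
    exists [set p | `|nrm p - q i| < dl i]; split.
    - exact: annulus_open.
    - by move=> p /Gn; rewrite lt_min => /andP[].
    - by move=> C' C'p C'n; apply: Gu => // p /C'n.
  exists (q i) => // d d0.
  have [e2 e20 he2] := (hdl i).2 d d0.
  apply: filterS (filterI (punctured_near e00) (punctured_near e20)) => e [ee ee2].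
  have [C [_ Cn Cr Cu]] := he2 e ee2.
  have [Gp Gn _ _] := hG i e ee.
  have -> : G (i, e) = C.
    by apply: Cu => // p /Gn; rewrite lt_min => /andP[].
  split=> p.
    move=> Cp; have p0 : 0 < nrm p.
      have := Gn p; have -> : G (i, e) = C.
        by apply: Cu => // z /Gn; rewrite lt_min => /andP[].
      move=> /(_ Cp); rewrite lt_min => /andP[_]; rewrite ltr_norml => /andP[h _].
      have : 1 <= q i by rewrite ler1n.
      by lra.
    have qp : 0 <= q i / nrm p by rewrite divr_ge0// ltW.
    exists (q i / nrm p * p.1, q i / nrm p * p.2).
      by apply/circleE; rewrite ?(ltW (q0 i))// nrmZ// divfK// gt_eqF.
    apply: ball_sym; apply: scaled_close.
    by rewrite divfK ?gt_eqF// distrC; exact: Cn.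
  move=> /(circleE _ (ltW (q0 i))) pq.
  have p0 : 0 < nrm p by rewrite pq.
  have [k k0 Ck] := Cr p p0; exists (k * p.1, k * p.2) => //.
  apply: ball_sym; apply: scaled_close.
  by have := Cn _ Ck; rewrite nrmZ ?ltW// pq.
have [_ Gi Gr _] := hG i e ee; have [_ Gj _ _] := hG j e ee.
have [k k0] := Gr (0, 1) ltac:(by rewrite /nrm norm2_gt0 oner_neq0 orbT).
move=> Gk; have hi := Gi _ Gk; rewrite GG in Gk; have hj := Gj _ Gk.
move: hi hj; set z := nrm _; rewrite !lt_min => /andP[_ hi] /andP[_ hj].
have : `|q i - q j| < 1.
  have -> : q i - q j = (z - q j) - (z - q i) by ring.
  by apply: (le_lt_trans (ler_normB _ _)); lra.
have [h|h|/val_inj h] := ltngtP (i : nat) j.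
- have : q i + 1 <= q j by rewrite /q natr1 ler_nat.
  by rewrite ltr_norml => h1 /andP[h2 h3]; lra.
- have : q j + 1 <= q i by rewrite /q natr1 ler_nat.
  by rewrite ltr_norml => h1 /andP[h2 h3]; lra.
- by rewrite h eqxx in ij.
Qed.

Lemma family_root (G : R -> set (R * R)) (e0 r : R) : 0 < e0 -> 0 < r ->
  (forall e, 0 < `|e| < e0 -> limit_cycle f g e (G e)) ->
  tends_to G (circle r) -> r \in pts R N.
Proof.
move=> e00 r0 Gl Gt; rewrite -Mroot//; apply/negPn/negP => Mr.
have [dl dl0 [e1 e10 none]] := no_root_no_orbit HM r0 Mr.
near (0 : R)^' => e.
have ee : 0 < `|e| < e0 by near: e; exact: punctured_near.
have ee1 : 0 < `|e| < e1 by near: e; exact: punctured_near.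
apply: (none e ee1 (G e) (Gl e ee).1).
by near: e; exact: tends_to_annulus.
Unshelve. all: by end_near.
Qed.

(** A limiting radius is a root of the average, and by local uniqueness two
    families tending to the same circle coincide for small parameters. *)
Lemma families_bound k (e0 : R) (G : 'I_k -> R -> set (R * R)) : 0 < e0 ->
  distinct_bifurcating f g e0 G -> (k <= N)%N.
Proof.
move=> e00 [Gb Gd].
have ex i : exists r, 0 < r /\ tends_to (G i) (circle r).
  by have [_ [r r0 Gr]] := Gb i; exists r.
have [r hr] := choice ex.
have rN i : r i \in pts R N.
  exact: (family_root e00 (hr i).1 (Gb i).1 (hr i).2).
suff rinj : injective r.
  rewrite -(size_pts R N) -[k in (k <= _)%N]card_ord cardE -(size_map r).
  apply: uniq_leq_size; first by rewrite map_inj_uniq ?enum_uniq.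
  by move=> _ /mapP[i _ ->].
move=> i j rij; apply/eqP/negPn/negP => ij.
have r0 := (hr i).1.
have Mr : M.[r i] = 0 by apply/rootP; rewrite Mroot// rN.
have [dl dl0 orb] := simple_root_orbit HM HM' r0 Mr (Msimple (rN i)).
have [e1 e10 he1] := orb 1 ltr01.
near (0 : R)^' => e.
have ee : 0 < `|e| < e0 by near: e; exact: punctured_near.
have ee1 : 0 < `|e| < e1 by near: e; exact: punctured_near.
have [C [_ _ _ Cu]] := he1 e ee1.
apply: (Gd e ee i j ij); transitivity C; last apply/esym; apply: Cu.
- exact: ((Gb i).1 e ee).1.
- by near: e; exact: tends_to_annulus (hr i).2.
- exact: ((Gb j).1 e ee).1.
- by near: e; rewrite rij; exact: tends_to_annulus (hr j).1 dl0 (hr j).2.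
Unshelve. all: by end_near.
Qed.

Lemma bif_numberE : bif_number f g = N%:R%:E.
Proof.
apply/le_anti/andP; split.
  apply: ge_ereal_sup => _ [k [e0 [G [e00 hG]]] <-].
  by rewrite lee_fin ler_nat; exact: families_bound e00 hG.
apply: ereal_sup_ubound; exists N => //.
by have [e0 [G h]] := families_exist; exists e0, G.
Qed.

End Families.
End Assembly.

Theorem theorem2 (R : realType) (n m : nat) (hn : (1 <= n)%N)
    (hm : (1 <= m)%N) :
  ((n %/ 2 + m %/ 2 + 1)%N%:R%:E <= max_bif_number R n m)%E /\
  exists (f g : {poly R}) (e0 : R)
         (G : 'I_(n %/ 2 + m %/ 2 + 1) -> R -> set (R * R)),
    [/\ size f = n.+1, size g = m.+1, 0 < e0,
        distinct_bifurcating f g e0 G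
      & bif_number f g = (n %/ 2 + m %/ 2 + 1)%N%:R%:E].
Proof.
have [f [g [M [sf sg HM HM' [Mroot Msimple]]]]] := prescribed_average R n m.
have bif := bif_numberE HM HM' Mroot Msimple.
have [e0 [G [e00 hG]]] := families_exist HM HM' Mroot Msimple.
split; last by exists f, g, e0, G.
by apply: ereal_sup_ubound; exists f, g.
Qed.
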